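(* Let $c>0$, $T>0$, and let $u$ be the exact solution of the obstacle problem $\min(u_t+cu_x,\,u-g(x))=0$, $u(0,x)=u_0(x)$ on $(0,1)$ with periodic boundary conditions. Assume that $u$ is not shattering on $[0,T]$ for some integer $\ell\ge 0$, i.e. there are constants $p,L,c_0$ such that $u(t,\cdot)\in\mathcal C^{\ell+1}_{p,L,c_0}(0,1)$ for all $t\in[0,T]$. Let $\tilde g$ be either $g_{\Delta t}$ or $x\mapsto\max(g(x),g(x-c\Delta t))$, and let $u_h^n\in V_h$ be defined by $$u_h^0=\Pi_h u_0,\qquad u_h^{n+1}=\Pi_h\big(\max(G^{SL}_{\Delta t}(u_h^n),\tilde g)\big),\quad n\ge 0 .$$ Write $u^n=u(t_n,\cdot)$, $t_n=n\Delta t$. Then there is a constant $C\ge 0$ independent of $n$ such that for all $n\ge0$ with $t_n\le T$ $$\|u_h^n-u^n\|\le CT\,\frac{h^{q_{k,\ell}}}{\Delta t}+CT\,\frac{\|\tilde g-g_{\Delta t}\|}{\Delta t}.$$ In particular: (i) if $\tilde g=g_{\Delta t}$, then for all $t_n\le T$, $\ \|u_h^n-u^n\|\le CT\,\dfrac{h^{q_{k,\ell}}}{\Delta t}$; (ii) if $\tilde g(x)=\max(g(x),g(x-c\Delta t))$ and $g\in\Delta^2_q(0,1)$ for some integer $q\geq 1$, then for all $t_n\le T$, $\ \|u_h^n-u^n\|\le CT\,\dfrac{h^{q_{k,\ell}}}{\Delta t}+CT\,\Delta t^{3/2}$.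
   Context: Periodicity: all functions on $(0,1)$ are identified with their $1$-periodic extensions, and the function classes below are understood for periodic functions. The data $u_0,g$ are Lipschitz continuous. Exact solution: the (viscosity) solution is $u(0,\cdot)=u_0$ and, for $t>0$, $u(t,x)=\max\big(u_0(x-ct),\,g_t(x)\big)$, where $g_t(x):=\max_{\theta\in[0,t]}g(x-c\theta)$. Mesh and space: $I_j=(x_{j-1/2},x_{j+1/2})$, $j=1,\dots,N$, is a partition of $(0,1)$, $h_j=|I_j|$, $h=\max_j h_j$. For a fixed integer $k\ge 0$, $V_h$ is the space of functions whose restriction to each $I_j$ is a polynomial of degree at most $k$. $\Pi_h$ is the $L^2$ projection onto $V_h$, and $\|\cdot\|$ is the $L^2(0,1)$ norm. $\Delta t$ is the time step, with $0<\Delta t\le T$. Semi-Lagrangian DG (SLDG) operator: $G^{SL}_{\Delta t}(v):=\Pi_h\big(v(\cdot-c\Delta t)\big)$. Function classes: $\mathcal C^{\ell+1}_{p,L,c_0}(0,1)$ is the set of $v:(0,1)\to\mathbb R$ that are Lipschitz continuous with $\|v'\|_{L^\infty}\le L$, piecewise $C^{\ell+1}$ with $\|v^{(\ell+1)}\|_{L^\infty}\le c_0$ (the derivative being taken almost everywhere), and have at most $p\ge 0$ non-regular points (points near which $v$ is not $C^{\ell+1}$). $\Delta^2_q(0,1)$ is the set of $g:(0,1)\to\mathbb R$ having at most $q$ local maximum points and twice differentiable at each local maximum. Exponent: $q_{k,\ell}:=\min\big(\min(k,\ell)+1,\tfrac32\big)$, i.e. $3/2$ if $k,\ell\ge1$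 and $1$ if $k=0$ or $\ell=0$. Constants $C$ depend only on the exact solution and data (and the fixed $c,k,\ell$), in particular not on $n$, $h$, the mesh or $\Delta t$; they may differ between occurrences. *)

(* Defs.v *)
From mathcomp Require Import all_boot all_order all_algebra.
From mathcomp Require Import all_classical all_reals all_analysis.

Set Implicit Arguments.
Unset Strict Implicit.
Unset Printing Implicit Defensive.

Import Order.TTheory GRing.Theory Num.Theory.
Import numFieldNormedType.Exports.

Local Open Scope classical_set_scope.
Local Open Scope ring_scope.

(* A function on (0,1) with periodic boundary conditions is represented by its
   1-periodic extension R -> R. *)

(* The L^r(0,1) norm; it is \bar R-valued, and r = +oo gives the essential
   supremum of |v| over (0,1). *)
Definition Lnorm01 (R : realType) (r : \bar R) (v : R -> R) : \bar R :=
  ('N[@lebesgue_measure R]_r[(EFin \o v) \_ `]0%R, 1%R[])%E.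

Definition L2norm01 (R : realType) (v : R -> R) : \bar R :=
  Lnorm01 2%:R%:E v.

(** Exact solution of the obstacle problem *)

(* The running maximum g_t; for continuous g and 0 <= t the supremum is
   attained. *)
Definition running_max (R : realType) (c : R) (g : R -> R) (t x : R) : R :=
  sup [set g (x - c * theta) | theta in `[0, t]].

Definition endpoint_max (R : realType) (c : R) (g : R -> R) (t x : R) : R :=
  Num.max (g x) (g (x - c * t)).

(* No compatibility g <= u0 is assumed, so at t = 0 the general formula would
   give max(u0, g) instead of the initial datum. *)
Definition exact_solution (R : realType) (c : R) (u0 g : R -> R) (t x : R) : R :=
  if t == 0 then u0 x
  else Num.max (u0 (x - c * t)) (running_max c g t x).

(** Function classes *)

(* v is of class C^m on a neighbourhood of x. *)
Definition smooth_near (R : realType) (m : nat) (v : R -> R) (x : R) : Prop :=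
  \forall y \near x,
    (forall i, (i < m)%N -> derivable (derive1n i v) y 1) /\
    {for y, continuous (derive1n m v)}.

(* Non-regular points are counted once per period. *)
Definition nonregular_points (R : realType) (m : nat) (v : R -> R) : set R :=
  [set x | 0 <= x < 1 /\ ~ smooth_near m v x].

(* The class C^m_{p,L,c0}(0,1). As there are finitely many non-regular points,
   [derive1 v] and [derive1n m v] are the genuine derivatives almost
   everywhere (for 0 < m), so the values of these total operators at the
   non-regular points do not affect the essential suprema. *)
Definition piecewise_C (R : realType) (m p : nat) (L c0 : R) (v : R -> R)
    : Prop :=
  [/\ periodic v 1,
      lipschitz v,
      (Lnorm01 +oo (derive1 v) <= L%:E)%E,
      (Lnorm01 +oo (derive1n m v) <= c0%:E)%E &
      (nonregular_points m v #<= `I_p)%card].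

Definition not_shattering (R : realType) (l p : nat) (L c0 T : R)
    (u : R -> R -> R) : Prop :=
  forall t, 0 <= t <= T -> piecewise_C l.+1 p L c0 (u t).

(* Not necessarily strict. *)
Definition local_maximum (R : realType) (g : R -> R) (x : R) : Prop :=
  \forall y \near x, g y <= g x.

Definition twice_differentiable_at (R : realType) (g : R -> R) (x : R) : Prop :=
  (\forall y \near x, derivable g y 1) /\ derivable (derive1 g) x 1.

(* The class Delta^2_q(0,1); local maximum points are counted once per
   period. *)
Definition Delta2 (R : realType) (q : nat) (g : R -> R) : Prop :=
  ([set x | (0 <= x < 1)%R /\ local_maximum g x] #<= `I_q)%card /\
  forall x, local_maximum g x -> twice_differentiable_at g x.

(** Mesh, piecewise polynomials and the scheme *)

(* A mesh is a sequence s with [itv_partition 0 1 s], that is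
   0 < s_0 < ... < s_(N-1) = 1 with N = size s. Its cells are the intervals
   ]mesh_left s j, mesh_right s j[ for j < N. *)
Definition mesh_left (R : realType) (s : seq R) (j : nat) : R := (0 :: s)`_j.
Definition mesh_right (R : realType) (s : seq R) (j : nat) : R := s`_j.

Definition mesh_size (R : realType) (s : seq R) : R :=
  \big[Num.max/0]_(j < size s) (mesh_right s j - mesh_left s j).

(* The space V_h; values at the mesh points are unconstrained. *)
Definition Vh (R : realType) (k : nat) (s : seq R) : set (R -> R) :=
  [set v | periodic v 1 /\
    forall j, (j < size s)%N -> exists2 P : {poly R}, (size P <= k.+1)%N &
      forall x, mesh_left s j < x < mesh_right s j -> v x = P.[x]].

(* w is the L^2(0,1) projection of v onto V_h (unique up to its values at the
   mesh points). *)
Definition is_L2proj (R : realType) (k : nat) (s : seq R) (v w : R -> R)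
    : Prop :=
  Vh k s w /\
  forall phi, Vh k s phi ->
    (\int[@lebesgue_measure R]_(x in `]0%R, 1%R[) (w x * phi x)%:E =
     \int[@lebesgue_measure R]_(x in `]0%R, 1%R[) (v x * phi x)%:E)%E.

(* w = G^SL_dt(v) *)
Definition is_GSL (R : realType) (k : nat) (s : seq R) (c dt : R)
    (v w : R -> R) : Prop :=
  is_L2proj k s (fun x => v (x - c * dt)) w.

Definition sldg_scheme (R : realType) (k : nat) (s : seq R) (c dt : R)
    (u0 gt : R -> R) (uh : nat -> R -> R) : Prop :=
  is_L2proj k s u0 (uh 0%N) /\
  forall n, exists2 w, is_GSL k s c dt (uh n) w &
    is_L2proj k s (fun x => Num.max (w x) (gt x)) (uh n.+1).

(* The exponent q_{k,l} *)
Definition rate (R : realType) (k l : nat) : R :=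
  Num.min (minn k l).+1%:R (3%:R / 2%:R).

(* Main.v *)
(* |P v - z| <= |v - z| in L^2 for the projection P and z in V_h, translations are
   isometries of L^2 of the circle, and the maximum is 1-Lipschitz. As
   u^(n+1) = max(u^n(. - c dt), g_dt), one step therefore increases the error
   by at most O(eta) + |gt - g_dt|, where eta is the best approximation error
   in V_h of the translates of the u^n; summing n + 1 <= 2 T / dt such terms
   gives the estimate.

   eta = O(h) for Lipschitz functions. If k, l >= 1, the function is
   interpolated linearly on each cell. The class only bounds the first and the
   (l+1)-st derivatives, but on a regular piece of length d an inequality of
   Landau-Kolmogorov type gives |v''| = O(1/d), which is enough for a
   contribution O(h^3) of each of the finitely many pieces to the squared
   error.

   For (ii), g_dt and max(g, g(. - c dt)) can differ at x only if g has a local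
   maximum at some y in ]x - c dt, x[; as g is twice differentiable at y, the
   difference is O(dt^2), and it lives on a set of measure O(dt). *)
Require Import Defs.
From mathcomp Require Import all_boot all_order all_algebra.
From mathcomp Require Import all_classical all_reals all_analysis.
From mathcomp Require Import measurable_realfun ess_sup_inf ring lra zify.

Set Implicit Arguments.
Unset Strict Implicit.
Unset Printing Implicit Defensive.

Import Order.TTheory GRing.Theory Num.Theory.
Import numFieldNormedType.Exports.

Local Open Scope classical_set_scope.
Local Open Scope ring_scope.

(** * Bounded measurable periodic functions and their L^2 norm *)

Section PeriodicL2.
Context {R : realType}.
Implicit Types (v w f : R -> R).
Local Notation mu := (@lebesgue_measure R).

(** A class stable under the operations of the scheme and of the error analysis. Boundedness makes
    the integrals over (0,1) finite, so norms can be treated as real numbers; periodicity gives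
    translation invariance. *)
Definition bperiodic v : Prop :=
  [/\ periodic v 1, measurable_fun setT v & exists M, forall x, `|v x| <= M].

Lemma bperiodic_opp v : bperiodic v -> bperiodic (\- v).
Proof.
move=> [pv mv [M hM]]; split; first by move=> x /=; rewrite pv.
  exact: measurableT_comp.
by exists M => x /=; rewrite normrN.
Qed.

Lemma bperiodic_add v w : bperiodic v -> bperiodic w -> bperiodic (v \+ w).
Proof.
move=> [pv mv [M hM]] [pw mw [M' hM']]; split.
- by move=> x /=; rewrite pv pw.
- exact: measurable_funD.
- by exists (M + M') => x /=; rewrite (le_trans (ler_normD _ _))// lerD.
Qed.

Lemma bperiodic_sub v w : bperiodic v -> bperiodic w -> bperiodic (v \- w).
Proof. by move=> nv nw; exact: bperiodic_add nv (bperiodic_opp nw). Qed.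

Lemma bperiodic_mul v w : bperiodic v -> bperiodic w -> bperiodic (v \* w).
Proof.
move=> [pv mv [M hM]] [pw mw [M' hM']]; split.
- by move=> x /=; rewrite pv pw.
- exact: measurable_funM.
- by exists (M * M') => x /=; rewrite normrM ler_pM.
Qed.

Lemma bperiodic_max v w : bperiodic v -> bperiodic w -> bperiodic (fun x => Num.max (v x) (w x)).
Proof.
move=> [pv mv [M hM]] [pw mw [M' hM']]; split.
- by move=> x /=; rewrite pv pw.
- exact: measurable_maxr.
- exists (Num.max M M') => x; rewrite le_max.
  by have [_|_] := leP (v x) (w x); rewrite ?hM ?hM' ?orbT.
Qed.

Lemma bperiodic_shift v a : bperiodic v -> bperiodic (fun x => v (x - a)).
Proof.
move=> [pv mv [M hM]]; split.
- by move=> x /=; rewrite addrAC pv.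
- apply: (measurableT_comp mv).
  by apply: measurable_funB => //; exact: measurable_id.
- by exists M => x.
Qed.

Lemma bperiodic_integrable f : bperiodic f -> mu.-integrable `]0, 1[ (EFin \o f).
Proof.
move=> [_ mf [M hM]]; apply: measurable_bounded_integrable.
- exact: measurable_itv.
- by rewrite /= lebesgue_measure_itv/= lte01 oppr0 adde0 ltry.
- exact: measurable_funTS.
- exists M; split; first exact: num_real.
  by move=> y My x _; exact: le_trans (hM x) (ltW My).
Qed.

Definition int01 f : R := \int[mu]_(x in `]0, 1[) f x.

(** Real-valued version of [L2norm01], with which it agrees on [bperiodic] functions by [L2norm01E];
    the error recursion then becomes linear arithmetic in [R]. *)
Definition L2 v : R := Num.sqrt (int01 (v \* v)).

Lemma int01_EFin f : bperiodic f -> (\int[mu]_(x in `]0%R, 1%R[) (f x)%:E)%E = (int01 f)%:E.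
Proof.
move=> nf; rewrite /int01 /Rintegral fineK//.
exact: (integrable_fin_num _ (bperiodic_integrable nf)).
Qed.

Lemma int01_ge0 f : (forall x, 0 <= f x) -> 0 <= int01 f.
Proof. by move=> f0; apply: Rintegral_ge0 => x _; exact: f0. Qed.

Lemma int01_sq_ge0 v : 0 <= int01 (v \* v).
Proof. by apply: int01_ge0 => x /=; rewrite -expr2 sqr_ge0. Qed.

Lemma L2_ge0 v : 0 <= L2 v. Proof. exact: sqrtr_ge0. Qed.

Lemma L2norm01E v : bperiodic v -> L2norm01 v = (L2 v)%:E.
Proof.
move=> nv; rewrite /L2norm01 /Lnorm01 unlock.
rewrite (_ : (\int[mu]_x _)%E = (int01 (v \* v))%:E).
  by rewrite poweR_EFin powR12_sqrt// int01_sq_ge0.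
rewrite -int01_EFin; last exact: bperiodic_mul.
rewrite [RHS]integral_mkcond; apply: eq_integral => x _.
rewrite !patchE; case: ifPn => _ /=.
  by rewrite (powR_mulrn 2)// real_normK ?num_real// expr2.
by rewrite normr0 powR0.
Qed.

Lemma le_int01 f1 f2 : bperiodic f1 -> bperiodic f2 ->
  (forall x, 0 < x < 1 -> f1 x <= f2 x) -> int01 f1 <= int01 f2.
Proof.
move=> n1 n2 h; apply: le_Rintegral; [exact: measurable_itv|exact: bperiodic_integrable..|].
by move=> x /=; rewrite in_itv/= => /h.
Qed.

Lemma int01D f1 f2 : bperiodic f1 -> bperiodic f2 ->
  int01 (f1 \+ f2) = int01 f1 + int01 f2.
Proof. by move=> n1 n2; apply: RintegralD => //; exact: bperiodic_integrable. Qed.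

Lemma int01B f1 f2 : bperiodic f1 -> bperiodic f2 ->
  int01 (f1 \- f2) = int01 f1 - int01 f2.
Proof. by move=> n1 n2; apply: RintegralB => //; exact: bperiodic_integrable. Qed.

Lemma le_L2 v w : bperiodic v -> bperiodic w ->
  (forall x, 0 < x < 1 -> `|v x| <= `|w x|) -> L2 v <= L2 w.
Proof.
move=> nv nw h; apply: ler_wsqrtr; apply: le_int01; [exact: bperiodic_mul..|].
move=> x /h vw /=; rewrite -!expr2 -[leLHS]real_normK ?num_real//.
by rewrite -[leRHS]real_normK ?num_real// lerXn2r ?nnegrE.
Qed.

(** Minkowski's inequality on the whole line, applied to the functions cut off outside (0,1). *)
Lemma L2_triangle v w : bperiodic v -> bperiodic w -> L2 (v \+ w) <= L2 v + L2 w.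
Proof.
move=> nv nw; rewrite -lee_fin EFinD -!L2norm01E//; last exact: bperiodic_add.
rewrite /L2norm01 /Lnorm01 !restrict_EFin.
rewrite (_ : (v \+ w) \_ _ = (v \_ `]0%R, 1%R[) \+ (w \_ `]0%R, 1%R[)).
  apply: minkowski_EFin; last by rewrite ler1n.
  - apply/(measurable_restrictT _ _).1 => //; apply: measurable_funTS.
    by case: nv.
  - apply/(measurable_restrictT _ _).1 => //; apply: measurable_funTS.
    by case: nw.
apply/funext => x /=; rewrite !patchE; case: ifPn => //=; by rewrite addr0.
Qed.

Lemma L2C v w : L2 (v \- w) = L2 (w \- v).
Proof.
by rewrite /L2; congr (Num.sqrt (int01 _)); apply/funext => x /=; ring.
Qed.

Lemma L2_triangle_sub u v w : bperiodic u -> bperiodic v -> bperiodic w ->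
  L2 (u \- w) <= L2 (u \- v) + L2 (v \- w).
Proof.
move=> nu nv nw; apply: le_trans (L2_triangle _ _); [|exact: bperiodic_sub..].
rewrite le_eqVlt; apply/orP; left; apply/eqP; congr L2.
by apply/funext => x /=; rewrite addrA subrK.
Qed.

End PeriodicL2.

(** * Translation invariance of integrals over a period *)

Section Shift.
Context {R : realType}.
Implicit Types (v w f : R -> R).
Local Notation mu := (@lebesgue_measure R).

Lemma periodicz f (n : int) x : periodic f 1 -> f (x + n%:~R) = f x.
Proof.
move=> pf; case: n => n; first by rewrite -[n%:~R]/(1 *+ n) periodicn.
by rewrite NegzE mulrNz -[in RHS](subrK (n.+1%:~R) x) -[n.+1%:~R]/(1 *+ n.+1) periodicn.
Qed.

Lemma integral_split f (a m b : R) : measurable_fun setT f ->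
  (forall x, 0 <= f x) -> a <= m <= b ->
  (\int[mu]_(x in `]a, b[) (f x)%:E =
   \int[mu]_(x in `]a, m[) (f x)%:E + \int[mu]_(x in `]m, b[) (f x)%:E)%E.
Proof.
move=> mf f0 /andP[am mb].
have mfE D : measurable_fun D (EFin \o f).
  by apply/measurable_funTS/measurable_EFinP.
move: am; rewrite le_eqVlt => /predU1P[->|am].
  by rewrite set_itvoo0 integral_set0 add0e.
move: mb; rewrite le_eqVlt => /predU1P[<-|mb].
  by rewrite set_itvoo0 integral_set0 adde0.
rewrite (@itv_bndbnd_setU _ _ _ (BRight m)) ?bnd_simp ?ltW//.
rewrite ge0_integral_setU//.
- by rewrite -integral_itv_bndo_bndc.
- exact: mfE.
- by move=> x _; rewrite lee_fin.
- apply/disj_setPS => y [/=]; rewrite 2!in_itv/= => /andP[_ ym] /andP[].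
  by rewrite ltNge ym.
Qed.

(** The pushforward gives each half-open interval its length, and Lebesgue measure is the only
    measure that does. *)
Lemma lebesgue_measure_shift (t : R) (A : set R) : measurable A ->
  pushforward mu ((fun x => x + t) : _ -> measurableTypeR R) A = mu A.
Proof.
have mt : measurable_fun setT ((fun x => x + t) : measurableTypeR R -> measurableTypeR R).
  by apply: measurable_funD => //; exact: measurable_id.
move=> mA; apply/esym.
pose nu : {measure set _ -> \bar R} :=
  pushforward mu ((fun x => x + t) : measurableTypeR R -> measurableTypeR R).
apply: (@lebesgue_measure_unique _ (nu mt)) => //= _ [[a b]] _ <-.
rewrite /nu /pushforward/= (_ : _ @^-1` _ = `]a - t, b - t]%classic); last first.
  by apply/seteqP; split=> x /=; rewrite !in_itv/= ltrBlDr lerBrDr.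
rewrite !lebesgue_measure_itv/= !lte_fin ltrD2r.
by case: ifP => // _; rewrite -!EFinB; congr EFin; ring.
Qed.

Lemma integral_shift f (t a b : R) : measurable_fun setT f ->
  (forall x, 0 <= f x) ->
  (\int[mu]_(x in `]a, b[) (f (x + t))%:E =
   \int[mu]_(x in `](a + t)%R, (b + t)%R[) (f x)%:E)%E.
Proof.
move=> mf f0.
have mt : measurable_fun setT ((fun x => x + t) : measurableTypeR R -> measurableTypeR R).
  by apply: measurable_funD => //; exact: measurable_id.
rewrite (_ : `]a, b[%classic = ((fun x => x + t) : _ -> measurableTypeR R) @^-1`
     `]a + t, b + t[); last first.
  by apply/seteqP; split=> x /=; rewrite !in_itv/= !ltrD2r.
rewrite -(@ge0_integral_pushforward _ _ _ _ _ _ mt mu _ (EFin \o f))//.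
- apply: eq_measure_integral => //= A mA _; exact: lebesgue_measure_shift.
- by apply/measurable_funTS/measurable_EFinP.
- by move=> x _; rewrite lee_fin.
Qed.

(** With n the floor of y, the window is cut at n + 1; translating the right piece back by 1
    completes the left piece to ]n, n + 1[, which is then moved to ]0, 1[. *)
Lemma integral_period f (y : R) : periodic f 1 -> measurable_fun setT f ->
  (forall x, 0 <= f x) ->
  (\int[mu]_(x in `]y, (y + 1)%R[) (f x)%:E =
   \int[mu]_(x in `]0%R, 1%R[) (f x)%:E)%E.
Proof.
move=> pf mf f0; set n := Num.floor y.
have ny : n%:~R <= y by exact: real_floor_le (num_real y).
have yn : y < n%:~R + 1 by have := real_floorD1_gt (num_real y); rewrite intrD.
rewrite (integral_split (m := n%:~R + 1))//; last first.
  by rewrite (ltW yn)/= lerD2r.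
rewrite -(integral_shift 1)//; under [X in (_ + X)%E]eq_integral do rewrite pf.
rewrite addeC -integral_split//; last by rewrite ny ltW.
have := @integral_shift f n%:~R 0 1 mf f0; rewrite add0r addrC => <-.
by apply: eq_integral => x _; rewrite periodicz.
Qed.

Lemma int01_shift f a : bperiodic f -> (forall x, 0 <= f x) ->
  int01 (fun x => f (x - a)) = int01 f.
Proof.
move=> [pf mf bf] f0; rewrite /int01 /Rintegral; congr fine.
by rewrite integral_shift// add0r [1 + _]addrC integral_period.
Qed.

Lemma L2_shift v a : bperiodic v -> L2 (fun x => v (x - a)) = L2 v.
Proof.
move=> nv; rewrite /L2; congr Num.sqrt.
apply: (@int01_shift (v \* v)); first exact: bperiodic_mul.
by move=> x /=; rewrite -expr2 sqr_ge0.
Qed.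

End Shift.

(** * Cells of a mesh, fractional parts, and regularity of the functions of V_h *)

Section Mesh.
Context {R : realType}.
Variable s : seq R.
Hypothesis hs : itv_partition 0 1 s.

Lemma mesh_sorted : sorted <%R (0 :: s).
Proof. by case: hs. Qed.

Lemma mesh_neq0 : (0 < size s)%N.
Proof.
case: s hs => //= -[_ /eqP] /= /esym /eqP; by rewrite oner_eq0.
Qed.

Lemma mesh_monotone i j : (i <= j <= size s)%N -> (0 :: s)`_i <= (0 :: s)`_j.
Proof.
move=> /andP[ij js].
apply: (sorted_leq_nth (@le_trans _ R) (@lexx _ R) 0 (sub_sorted (@ltW _ R) mesh_sorted)) => //.
by rewrite inE/= ltnS (leq_trans ij).
Qed.

Lemma mesh_lt j : (j < size s)%N -> mesh_left s j < mesh_right s j.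
Proof.
move=> js; apply: (sorted_ltn_nth (@lt_trans _ R) 0 mesh_sorted j j.+1) => //.
by rewrite inE/= ltnS ltnW.
Qed.

Lemma mesh_last : (0 :: s)`_(size s) = 1.
Proof.
case: hs => _ /eqP <-; rewrite (last_nth 0).
by case: s.
Qed.

Lemma mesh_left_ge0 j : (j < size s)%N -> 0 <= mesh_left s j.
Proof. by move=> js; apply: (@mesh_monotone 0 j) => /=; exact: ltnW. Qed.

Lemma mesh_right_le1 j : (j < size s)%N -> mesh_right s j <= 1.
Proof.
by move=> js; rewrite -mesh_last; apply: (@mesh_monotone j.+1); rewrite js leqnn.
Qed.

Lemma cell_le_mesh_size j : (j < size s)%N ->
  mesh_right s j - mesh_left s j <= mesh_size s.
Proof.
move=> js; rewrite /mesh_size.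
exact: (@le_bigmax_cond _ _ _ 0 (Ordinal js) xpredT
  (fun i : 'I_(size s) => mesh_right s i - mesh_left s i)).
Qed.

Lemma mesh_size_gt0 : 0 < mesh_size s.
Proof.
apply: lt_le_trans (cell_le_mesh_size mesh_neq0).
by rewrite subr_gt0 mesh_lt// mesh_neq0.
Qed.

(** Meant for x in [0,1): the first mesh point strictly to the right of x ends its cell, so cells
    are half-open, closed on the left. *)
Definition cell_of (x : R) : nat := find (fun b => x < b) s.

Lemma cell_ofP x : 0 <= x < 1 -> (cell_of x < size s)%N /\
  mesh_left s (cell_of x) <= x < mesh_right s (cell_of x).
Proof.
move=> /andP[x0 x1].
have xs : has (fun b => x < b) s.
  apply/hasP; exists 1 => //; rewrite -mesh_last.
  move: mesh_neq0; case: (s) => //= a t _.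
  by apply: mem_nth => /=; exact: leqnn.
split; first by rewrite -has_find.
apply/andP; split; last exact: (nth_find 0 xs).
rewrite /mesh_left; case E: (cell_of x) => [//|i] /=.
have := @before_find _ 0 (fun b => x < b) s i.
by rewrite -/(cell_of x) E ltnSn => /(_ isT) /negbT; rewrite -leNgt.
Qed.

Lemma cell_of_eq x j : (j < size s)%N ->
  mesh_left s j <= x < mesh_right s j -> cell_of x = j.
Proof.
move=> js /andP[lx xr].
have x01 : 0 <= x < 1.
  by rewrite (le_trans (mesh_left_ge0 js))//= (lt_le_trans xr)// mesh_right_le1.
have [cs /andP[cl cr]] := cell_ofP x01.
apply/eqP; rewrite eqn_leq; apply/andP; split; rewrite leqNgt; apply/negP => h.
  suff : mesh_right s j <= mesh_left s (cell_of x) by lra.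
  by apply: (@mesh_monotone j.+1); rewrite h ltnW.
suff : mesh_right s (cell_of x) <= mesh_left s j by lra.
by apply: (@mesh_monotone (cell_of x).+1); rewrite h ltnW.
Qed.

Definition fpart (x : R) : R := x - (Num.floor x)%:~R.

Lemma fpartP x : 0 <= fpart x < 1.
Proof.
rewrite /fpart subr_ge0 ltrBlDl real_floor_le ?num_real//=.
by have := real_floorD1_gt (num_real x); rewrite intrD addrC.
Qed.

Lemma fpart_id x : 0 <= x < 1 -> fpart x = x.
Proof.
move=> x01; rewrite /fpart (_ : Num.floor x = 0) ?subr0//.
by apply: floor_def; rewrite add0r.
Qed.

Lemma fpart_periodic : periodic fpart 1.
Proof.
move=> x; rewrite /fpart (_ : Num.floor (x + 1) = Num.floor x + 1); last first.
  apply: floor_def; have := real_floor_le (num_real x).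
  by have := real_floorD1_gt (num_real x); rewrite !intrD lerD2r ltrD2r => -> ->.
by rewrite intrD; lra.
Qed.

Lemma periodic_fpart (f : R -> R) x : periodic f 1 -> f (fpart x) = f x.
Proof. by move=> pf; rewrite /fpart -mulrNz periodicz. Qed.

Lemma measurable_fpart : measurable_fun setT fpart.
Proof.
apply: measurable_funB; first exact: measurable_id.
apply: nondecreasing_measurable => //= x y xy.
by rewrite ler_int le_floor.
Qed.

(** A function of V_h is arbitrary at mesh points, so each half-open cell is treated as its left end
    point together with the open cell, where the function is a polynomial. Finitely many cells and
    periodicity give measurability and a global bound. *)
Lemma bperiodic_Vh k (v : R -> R) : Vh k s v -> bperiodic v.
Proof.
move=> [pv hv]; split => //.
- pose F j := if (j < size s)%N then `[mesh_left s j, mesh_right s j[%classic else set0 : set R.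
  have UF : `[0%R, 1%R[%classic = \bigcup_j F j.
    apply/seteqP; split => x /=.
      rewrite in_itv/= => /cell_ofP[cs cx]; exists (cell_of x) => //.
      by rewrite /F cs/= in_itv.
    move=> [j _]; rewrite /F; case: ifPn => // js /=; rewrite !in_itv/= => /andP[lx xr].
    by rewrite (le_trans (mesh_left_ge0 js))//= (lt_le_trans xr)// mesh_right_le1.
  have mv : measurable_fun (`[(0 : R), 1[%classic : set R) v.
    rewrite UF; apply/measurable_fun_bigcup => [j|j]; rewrite /F.
      by case: ifPn => // _; exact: measurable_itv.
    case: ifPn => js; last exact: measurable_fun_set0.
    have [P _ hP] := hv j js.
    rewrite -(setU1itv false) ?bnd_simp ?mesh_lt//.
    apply/measurable_funU; [exact: measurable_set1|exact: measurable_itv|split].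
      exact: measurable_fun_set1.
    apply: (@eq_measurable_fun _ _ _ _ _ (fun x => P.[x])); last exact: measurable_poly.
    by move=> x; rewrite inE/= in_itv/= => /hP.
  rewrite (_ : v = (v \_ `[0%R, 1%R[) \o fpart); last first.
    apply/funext => x /=; rewrite patchE mem_set ?periodic_fpart//=.
    by rewrite in_itv/= fpartP.
  apply: measurableT_comp; last exact: measurable_fpart.
  by apply/(measurable_restrictT _ _).1 => //; exact: measurable_itv.
- suff [B hB] : exists B : nat -> R, forall j x, (j < size s)%N ->
      mesh_left s j <= x < mesh_right s j -> `|v x| <= B j.
    exists (\big[Num.max/0]_(j < size s) B j) => x.
    rewrite -(periodic_fpart x pv); have [cs cx] := cell_ofP (fpartP x).
    apply: le_trans (hB _ _ cs cx) _.
    exact: (@le_bigmax_cond _ _ _ 0 (Ordinal cs) xpredT (fun i : 'I_(size s) => B i)).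
  suff /choice[B hB] : forall j, exists M, forall x, (j < size s)%N ->
      mesh_left s j <= x < mesh_right s j -> `|v x| <= M by exists B.
  move=> j.
  have [js|js] := boolP (j < size s)%N; last by exists 0.
  have [P _ hP] := hv j js.
  have [c _ hc] := @EVT_max R (fun x => `|P.[x]|) (mesh_left s j) (mesh_right s j)
    (ltW (mesh_lt js)) (continuous_subspaceT
       (fun x => continuous_comp (@continuous_horner _ P x) (@norm_continuous _ _ _))).
  exists (Num.max `|v (mesh_left s j)| `|P.[c]|) => x _.
  rewrite le_eqVlt => /andP[/predU1P[<-|lx] xr]; rewrite le_max ?lexx// orbC.
  by rewrite hP ?lx// hc// in_itv/= !ltW.
Qed.

End Mesh.

(** * Stability of the L^2 projection *)

Section Projection.
Context {R : realType}.
Variable s : seq R.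
Hypothesis hs : itv_partition 0 1 s.

Lemma Vh_sub k (v w : R -> R) : Vh k s v -> Vh k s w -> Vh k s (v \- w).
Proof.
move=> [pv hv] [pw hw]; split; first by move=> x /=; rewrite pv pw.
move=> j js; have [P sP hP] := hv j js; have [Q sQ hQ] := hw j js.
exists (P - Q); last by move=> x xj /=; rewrite hP// hQ// hornerD hornerN.
by rewrite (leq_trans (size_polyD _ _))// size_polyN geq_max sP.
Qed.

(** Evaluating at the fractional part makes the function periodic, and [cell_of] fixes its values at
    the left mesh points too, so the formula holds on half-open cells. *)
Lemma Vh_cellwise k (P : nat -> {poly R}) : (forall j, (size (P j) <= k.+1)%N) ->
  exists2 z, Vh k s z &
    forall j x, (j < size s)%N -> mesh_left s j <= x < mesh_right s j ->
      z x = (P j).[x].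
Proof.
move=> sP.
have zE j x : (j < size s)%N -> mesh_left s j <= x < mesh_right s j ->
    (P (cell_of s (fpart x))).[fpart x] = (P j).[x].
  move=> js xj; rewrite fpart_id ?(cell_of_eq hs js xj)//.
  case/andP: xj => lx xr.
  by rewrite (le_trans (mesh_left_ge0 hs js))//= (lt_le_trans xr)// mesh_right_le1.
exists (fun x => (P (cell_of s (fpart x))).[fpart x]); last exact: zE.
split; first by move=> x; rewrite fpart_periodic.
move=> j js; exists (P j) => // x /andP[lx xr].
by apply: zE => //; rewrite (ltW lx).
Qed.

(** The difference d = w - z lies in V_h and may serve as test function: with e = v - z this gives
    |d|^2 = <e, d>, and 2 <e, d> <= |e|^2 + |d|^2 concludes without the Cauchy-Schwarz
    inequality. *)
Lemma L2proj_stable k (v w z : R -> R) : bperiodic v -> is_L2proj k s v w ->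
  Vh k s z -> L2 (w \- z) <= L2 (v \- z).
Proof.
move=> nv [Vw hw] Vz; have Vd := Vh_sub Vw Vz.
have nw := bperiodic_Vh hs Vw; have nz := bperiodic_Vh hs Vz; have nd := bperiodic_sub nw nz.
have nvz := bperiodic_sub nv nz.
set d := w \- z in Vd nd *; set e := v \- z in nvz *.
apply: ler_wsqrtr.
have wd_vd : int01 (w \* d) = int01 (v \* d).
  have /= := hw _ Vd.
  by rewrite !(int01_EFin (bperiodic_mul _ _))// => -[].
have dd : int01 (d \* d) = int01 (e \* d).
  rewrite (_ : d \* d = (w \* d) \- (z \* d)); last first.
    by apply/funext => x /=; rewrite /d /=; ring.
  rewrite (_ : e \* d = (v \* d) \- (z \* d)); last first.
    by apply/funext => x /=; rewrite /e /=; ring.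
  by rewrite !int01B ?wd_vd//; exact: bperiodic_mul.
have : int01 (e \* d) + int01 (e \* d) <= int01 (e \* e) + int01 (d \* d).
  rewrite -!int01D; [|exact: bperiodic_mul..].
  apply: le_int01; [by apply: bperiodic_add; exact: bperiodic_mul..|].
  by move=> x _ /=; have := sqr_ge0 (e x - d x); nra.
lra.
Qed.

(* Comparing with an arbitrary z in V_h avoids the existence of the
   projection of y. *)
Lemma L2proj_error k (v w y z : R -> R) : bperiodic v -> is_L2proj k s v w ->
  bperiodic y -> Vh k s z -> L2 (w \- y) <= L2 (v \- y) + 2 * L2 (y \- z).
Proof.
move=> nv hw ny Vz; have nz := bperiodic_Vh hs Vz; have nw := bperiodic_Vh hs hw.1.
have := L2proj_stable nv hw Vz.
have := L2_triangle_sub nw nz ny.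
have := L2_triangle_sub nv ny nz.
rewrite (L2C z y); lra.
Qed.

End Projection.

(** * Lipschitz functions and the running maximum *)

Section RunningMax.
Context {R : realType}.
Implicit Types (g f v : R -> R).

(** The constant is explicit so that a single one can serve the exact solution at all times. *)
Definition lip (K : R) f := forall x y, `|f x - f y| <= K * `|x - y|.

Lemma lipschitz_lip f : lipschitz f -> exists2 K, 0 <= K & lip K f.
Proof.
(* [lipschitz] gives the bound for all constants strictly above M; M + 1 is one, and the maximum
   with 0 makes it nonnegative. *)
move=> [M [_ hM]]; exists (Num.max 0 (M + 1)); first by rewrite le_max lexx.
move=> x y; have := hM (Num.max 0 (M + 1)).
rewrite lt_max ltrDl ltr01 orbT => /(_ isT (x, y)); exact.
Qed.

Lemma lip_le K K' f : K <= K' -> lip K f -> lip K' f.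
Proof. by move=> KK' h x y; rewrite (le_trans (h x y))// ler_wpM2r. Qed.

Lemma lip_shift K f a : lip K f -> lip K (fun x => f (x - a)).
Proof.
by move=> h x y; rewrite (le_trans (h _ _))// (_ : x - a - (y - a) = x - y)//; ring.
Qed.

Lemma ler_dist_max (a b a' b' e : R) : `|a - a'| <= e -> `|b - b'| <= e ->
  `|Num.max a b - Num.max a' b'| <= e.
Proof.
rewrite !ler_norml => /andP[h1 h2] /andP[h3 h4].
by case: (leP a b) => h; case: (leP a' b') => h'; apply/andP; split; lra.
Qed.

Lemma lip_max K f v : lip K f -> lip K v -> lip K (fun x => Num.max (f x) (v x)).
Proof. by move=> hf hv x y; exact: ler_dist_max. Qed.

Lemma lip_continuous K f : lip K f -> continuous f.
Proof.
move=> h x; apply/cvgrPdist_lt => e e0.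
near=> y; rewrite (le_lt_trans (h x y))//.
have K0 : 0 < `|K| + 1 by rewrite ltr_wpDl.
rewrite (@le_lt_trans _ _ ((`|K| + 1) * `|x - y|))//.
  by rewrite ler_wpM2r// (le_trans (ler_norm K))// lerDl.
rewrite mulrC -ltr_pdivlMr//.
near: y; apply/nbhs_ballP; exists (e / (`|K| + 1)) => //=.
by rewrite divr_gt0.
Unshelve. all: by end_near. Qed.

Lemma bperiodic_lip K f : periodic f 1 -> lip K f -> bperiodic f.
Proof.
move=> pf hf; split => //.
  by apply: continuous_measurable_fun; exact: lip_continuous hf.
exists (`|f 0| + `|K|) => x; rewrite -(periodic_fpart x pf).
have /andP[x0 x1] := fpartP x.
rewrite -[f (fpart x)](subrK (f 0)) addrC (le_trans (ler_normD _ _))// lerD2l.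
rewrite (le_trans (hf _ _))// subr0 (ger0_norm x0).
rewrite (@le_trans _ _ (`|K| * fpart x))//; first by rewrite ler_wpM2r// ler_norm.
by rewrite ler_piMr// ltW.
Qed.

Variables (c : R) (g : R -> R).
Hypothesis cg : continuous g.

(** The extreme value theorem. Running maxima are compared below through a maximiser and the upper
    bound property rather than as suprema. *)
Lemma running_max_attained t x : 0 <= t ->
  exists th, [/\ 0 <= th <= t, running_max c g t x = g (x - c * th) &
    forall th', 0 <= th' <= t -> g (x - c * th') <= running_max c g t x].
Proof.
move=> t0.
have cf : {within `[0, t], continuous (fun th => g (x - c * th))}.
  apply: continuous_subspaceT => y.
  apply: (@continuous_comp _ _ _ (fun th => x - c * th) g); last exact: cg.
  apply: cvgB; first exact: cvg_cst.
  by apply: cvgMl_tmp; exact: cvg_id.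
have [th tht hmax] := EVT_max t0 cf.
exists th; rewrite in_itv/= in tht.
have E : running_max c g t x = g (x - c * th).
  apply/eqP; rewrite eq_le; apply/andP; split.
    apply: ge_sup; first by exists (g (x - c * th)), th => //=; rewrite in_itv.
    by move=> _ [y yt <-]; exact: hmax.
  apply: ub_le_sup; first by exists (g (x - c * th)) => _ [y yt <-]; exact: hmax.
  by exists th => //=; rewrite in_itv.
by split => // th' h; rewrite E; apply: hmax; rewrite in_itv.
Qed.

(** A maximising delay for x is a competitor for y, and the two shifted points are still at distance
    |x - y|. *)
Lemma lip_running_max K t : 0 <= t -> lip K g -> lip K (running_max c g t).
Proof.
move=> t0 hg.
have half x y : running_max c g t x - running_max c g t y <= K * `|x - y|.
  have [th [tht -> _]] := running_max_attained x t0.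
  have [_ [_ _ /(_ th tht) h]] := running_max_attained y t0.
  have := le_trans (ler_norm _) (hg (x - c * th) (y - c * th)).
  by rewrite (_ : x - c * th - (y - c * th) = x - y); [lra|ring].
by move=> x y; rewrite ler_norml half andbT lerNl opprB distrC half.
Qed.

Lemma running_max_periodic t : periodic g 1 -> periodic (running_max c g t) 1.
Proof.
move=> pg x; rewrite /running_max; congr sup; apply/seteqP; split => _ [th h <-];
  by exists th => //; rewrite addrAC pg.
Qed.

(** The delays in [0, t + d] are split at d: a delay th beyond d is the delay th - d as seen from x
    - c d. *)
Lemma running_maxD t d x : 0 <= t -> 0 <= d ->
  running_max c g (t + d) x =
  Num.max (running_max c g t (x - c * d)) (running_max c g d x).
Proof.
move=> t0 d0.
have [th [tht E h]] := running_max_attained x (addr_ge0 t0 d0).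
have [th1 [tht1 E1 h1]] := running_max_attained (x - c * d) t0.
have [th2 [tht2 E2 h2]] := running_max_attained x d0.
apply/eqP; rewrite eq_le; apply/andP; split; last first.
  rewrite ge_max E1 E2.
  rewrite (_ : x - c * d - c * th1 = x - c * (d + th1)); last by ring.
  by rewrite !h//; lra.
rewrite E le_max; have [thd|dth] := leP th d.
  by rewrite h2 ?orbT//; lra.
have := h1 (th - d); rewrite (_ : x - c * d - c * (th - d) = x - c * th); last by ring.
by move=> -> //; lra.
Qed.
End RunningMax.

(** * One-step formula for the exact solution and accumulation of errors *)

Section ErrorRecursion.
Context {R : realType}.
Variables (c : R) (u0 g : R -> R) (K : R).
Hypotheses (u0_periodic : periodic u0 1) (g_periodic : periodic g 1).
Hypotheses (u0_lip : lip K u0) (g_lip : lip K g).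

Let cg : continuous g := lip_continuous g_lip.

Lemma exact_solution_lip t : 0 <= t -> lip K (exact_solution c u0 g t).
Proof.
move=> t0; rewrite /exact_solution.
have [_|t_neq0] := eqVneq t 0; first exact: u0_lip.
by apply: lip_max; [exact: lip_shift|exact: lip_running_max].
Qed.

Lemma exact_solution_periodic t : periodic (exact_solution c u0 g t) 1.
Proof.
move=> x; rewrite /exact_solution; case: eqP => _; first exact: u0_periodic.
by rewrite addrAC u0_periodic running_max_periodic.
Qed.

Lemma bperiodic_exact_solution t : 0 <= t -> bperiodic (exact_solution c u0 g t).
Proof.
move=> t0; apply: bperiodic_lip (exact_solution_lip t0).
exact: exact_solution_periodic.
Qed.

Lemma bperiodic_running_max t : 0 <= t -> bperiodic (running_max c g t).
Proof.
by move=> t0; apply: (@bperiodic_lip _ K); [exact: running_max_periodic|exact: lip_running_max].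
Qed.

Lemma bperiodic_endpoint_max t : bperiodic (endpoint_max c g t).
Proof.
apply: bperiodic_max; first exact: bperiodic_lip g_lip.
by apply: bperiodic_shift; exact: bperiodic_lip g_lip.
Qed.

(** The exact solution obeys the recursion that the scheme discretises. At t = 0 the formula starts
    from the initial datum itself, which may lie below the obstacle; for t > 0 it follows from
    [running_maxD]. *)
Lemma exact_solutionD t dt x : 0 <= t -> 0 < dt ->
  exact_solution c u0 g (t + dt) x =
  Num.max (exact_solution c u0 g t (x - c * dt)) (running_max c g dt x).
Proof.
move=> t0 dt0; rewrite /exact_solution gt_eqF ?ltr_wpDl//.
have [->|_] := eqVneq t 0; first by rewrite add0r.
rewrite running_maxD// 1?ltW// maxA.
by rewrite (_ : x - c * (t + dt) = x - c * dt - c * t)//; ring.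
Qed.

Variables (k : nat) (s : seq R) (dt : R) (gt : R -> R) (uh : nat -> R -> R).
Hypotheses (hs : itv_partition 0 1 s) (dt0 : 0 < dt) (ngt : bperiodic gt).
Hypothesis scheme : sldg_scheme k s c dt u0 gt uh.

(** Each step makes two projections, compared with the translate of u^n and with u^(n+1); by
    [L2proj_error] each costs 2 eta, and the projection of the initial datum costs another 2 eta.
    The obstacle error enters once per step. *)
Lemma scheme_error (n : nat) (eta : R) :
  (forall m tau, (m <= n)%N -> exists2 z, Vh k s z &
    L2 ((fun x => exact_solution c u0 g (m%:R * dt) (x - tau)) \- z) <= eta) ->
  L2 (uh n \- exact_solution c u0 g (n%:R * dt)) <=
    (4 * n%:R + 2) * eta + n%:R * L2 (gt \- running_max c g dt).
Proof.
pose u m := exact_solution c u0 g (m%:R * dt).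
have nu m : bperiodic (u m) by apply: bperiodic_exact_solution; rewrite mulr_ge0// ltW.
have nrm := bperiodic_running_max (ltW dt0).
have Vuh m : Vh k s (uh m).
  by case: m => [|m]; [exact: scheme.1.1|have [w _ []] := scheme.2 m].
have nuh m : bperiodic (uh m) := bperiodic_Vh hs (Vuh m).
elim: n => [|n IH] happ.
  have [z Vz] := happ 0%N 0 (leqnn _).
  have u0E : exact_solution c u0 g (0%:R * dt) = u0.
    by apply/funext => x; rewrite mul0r /exact_solution eqxx.
  rewrite u0E mulr0 add0r mul0r addr0.
  have n0 : bperiodic u0 by exact: bperiodic_lip u0_lip.
  have -> : (fun x => u0 (x - 0)) = u0 by apply/funext => x; rewrite subr0.
  move=> hz; apply: le_trans (L2proj_error hs n0 scheme.1 n0 Vz) _.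
  have -> : L2 (u0 \- u0) = 0.
    rewrite /L2 (_ : _ \* _ = cst 0); last first.
      by apply/funext => x /=; rewrite subrr mul0r.
    by rewrite /int01 Rintegral_cst ?mul0r ?sqrtr0//; exact: measurable_itv.
  by rewrite add0r ler_pM2l.
have {}IH := IH (fun m tau mn => happ m tau (leqW mn)).
have [w hw huh] := scheme.2 n.
have Vw := hw.1; have nw := bperiodic_Vh hs Vw.
have [z Vz hz] := happ n.+1 0 (leqnn _).
have [z' Vz' hz'] := happ n (c * dt) (leqnSn _).
have nsu := bperiodic_shift (c * dt) (nu n); have nsuh := bperiodic_shift (c * dt) (nuh n).
have e1 := L2proj_error hs nsuh hw nsu Vz'.
have e2 := L2proj_error hs (bperiodic_max nw ngt) huh (nu n.+1) Vz.
have E : L2 ((fun x => u n.+1 (x - 0)) \- z) = L2 (u n.+1 \- z).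
  by congr L2; apply/funext => x /=; rewrite subr0.
rewrite -/(u n.+1) E in hz; rewrite -/(u n) in hz'.
(* Pointwise, a difference of maxima is at most the sum of the absolute differences of the
   arguments; replacing a function by its absolute value does not change [L2]. *)
have e3 : L2 ((fun x => Num.max (w x) (gt x)) \- u n.+1) <=
    L2 (w \- (fun x => u n (x - c * dt))) + L2 (gt \- running_max c g dt).
  have nd1 := bperiodic_sub nw nsu; have nd2 := bperiodic_sub ngt nrm.
  have nabs (v : R -> R) : bperiodic v -> bperiodic (fun x => `|v x|).
    move=> [pv mv [M hM]]; split; first by move=> x /=; rewrite pv.
      exact: measurableT_comp.
    by exists M => x /=; rewrite normr_id.
  have L2abs (v : R -> R) : L2 (fun x => `|v x|) = L2 v.
    rewrite /L2; congr (Num.sqrt (int01 _)); apply/funext => x /=.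
    by rewrite -!expr2 real_normK ?num_real.
  rewrite -(L2abs (w \- _)) -(L2abs (gt \- _)).
  apply: le_trans (L2_triangle (nabs _ nd1) (nabs _ nd2)).
  apply: le_L2.
  - by apply: bperiodic_sub (nu _); exact: bperiodic_max.
  - by apply: bperiodic_add; exact: nabs.
  - move=> x _ /=; rewrite [leRHS]ger0_norm ?addr_ge0//.
    rewrite /u mulrSr mulrDl mul1r exact_solutionD//; last by rewrite mulr_ge0// ltW.
    by apply: ler_dist_max; rewrite ?lerDl ?lerDr.
have e4 : L2 ((fun x => uh n (x - c * dt)) \- (fun x => u n (x - c * dt))) =
    L2 (uh n \- u n).
  exact: (L2_shift (c * dt) (bperiodic_sub (nuh n) (nu n))).
rewrite e4 in e1; rewrite -[L2 (uh n \- _)]/(L2 (uh n \- u n)) in IH.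
rewrite -/(u n.+1); lra.
Qed.

End ErrorRecursion.

(** * Mean value theorem, Landau-Kolmogorov inequality and linear interpolation *)

Section DerivativeBounds.
Context {R : realType}.
Implicit Types (f v : R -> R).

Lemma derive1n_derive1 f n : derive1n n (derive1 f) = derive1n n.+1 f.
Proof. by rewrite /derive1n iterSr. Qed.

Lemma derivable_is_derive f x : derivable f x 1 -> is_derive x 1 f (derive1 f x).
Proof. by move=> df; rewrite derive1E; exact: DeriveDef. Qed.

Lemma MVT_open f (a b : R) : a < b -> (forall z, a < z < b -> derivable f z 1) ->
  {within `[a, b], continuous f} ->
  exists2 xi, a < xi < b & f b - f a = derive1 f xi * (b - a).
Proof.
move=> ab df cf.
have [|xi] := @MVT R f (derive1 f) a b ab _ cf.
  by move=> z; rewrite in_itv/= => /df; exact: derivable_is_derive.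
by rewrite in_itv/= => xiab E; exists xi.
Qed.

(** The points x and y come in any order and may coincide; the middle clause, which keeps xi as
    close to x as y is, allows a bound on the derivative near x to be used at xi. *)
Lemma MVT_between f (a b x y : R) : (forall z, a <= z <= b -> derivable f z 1) ->
  a <= x <= b -> a <= y <= b -> exists xi,
  [/\ a <= xi <= b, `|xi - x| <= `|y - x| & f y - f x = derive1 f xi * (y - x)].
Proof.
move=> df xab yab.
have cf u w : a <= u -> w <= b -> {within `[u, w], continuous f}.
  move=> au wb; apply: derivable_within_continuous => z; rewrite in_itv/= => /andP[uz zw].
  by apply: df; lra.
have [xy|yx|<-] := ltgtP x y.
- have [||xi xixy E] := @MVT_open f x y xy; [|by apply: cf; lra|].
    by move=> z zxy; apply: df; lra.
  by exists xi; split => //; [lra|rewrite !ger0_norm; lra].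
- have [||xi xixy E] := @MVT_open f y x yx; [|by apply: cf; lra|].
    by move=> z zxy; apply: df; lra.
  by exists xi; split => //; [lra|rewrite !ler0_norm; lra|lra].
- by exists x; split => //; rewrite !subrr mulr0.
Qed.

(* A one-dimensional Landau-Kolmogorov inequality. The maximum S of |f'| is
   compared with a difference quotient of f of step proportional to b - a,
   and f'' is bounded in terms of S by induction. *)
Lemma landau_kolmogorov (m : nat) : exists2 C : R, 0 <= C &
  forall f (a b M0 M : R), a < b -> 0 <= M0 -> 0 <= M ->
  (forall x i, a <= x <= b -> (i <= m)%N -> derivable (derive1n i f) x 1) ->
  (forall x, a <= x <= b -> `|f x| <= M0) ->
  (forall x, a <= x <= b -> `|derive1n m.+1 f x| <= M) ->
  forall x, a <= x <= b -> `|derive1 f x| <= C * (M0 / (b - a) + M * (b - a) ^+ m).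
Proof.
elim: m => [|m [C C0 IH]].
  exists 1 => // f a b M0 M ab M00 M0' _ _ h x xab.
  rewrite mul1r expr0 mulr1 (le_trans (h x xab))// lerDr divr_ge0//; lra.
(* With d = b - a and S the maximum of |f'|, the proof reaches S <= (4 C + 4) M0 / d + S / 2 + M
   d^(m+1) / 2; solving for S gives this constant. *)
exists (8 * C + 8); first by lra.
move=> f a b M0 M ab M00 M0' df hf hM.
set d := b - a; have d0 : 0 < d by rewrite /d; lra.
have df0 z : a <= z <= b -> derivable f z 1 by move=> zab; exact: (df z 0%N).
have df1 z : a <= z <= b -> derivable (derive1 f) z 1 by move=> zab; exact: (df z 1%N).
have [xm] : exists2 xm, xm \in `[a, b] &
    forall t, t \in `[a, b] -> `|derive1 f t| <= `|derive1 f xm|.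
  apply: (@EVT_max R (fun x => `|derive1 f x|)); first exact: ltW.
  have c1 : {within `[a, b], continuous (derive1 f)}.
    by apply: derivable_within_continuous => z; rewrite in_itv/= => /df1.
  by move=> z; apply: continuous_comp; [exact: c1|exact: norm_continuous].
rewrite in_itv/= => xmab xmmax; set S := `|derive1 f xm| in xmmax *.
have S0 : 0 <= S by exact: normr_ge0.
have f2 z : a <= z <= b -> `|derive1n 2 f z| <= C * (S / d + M * d ^+ m).
  move=> zab; rewrite -derive1n_derive1; apply: (IH (derive1 f) a b S M) => //.
  - by move=> x i xab im; rewrite derive1n_derive1; exact: df.
  - by move=> x xab; rewrite derive1n_derive1; exact: hM.
set B := C * _ in f2.
(* This step satisfies C e <= d / 2, so that the part of |f''| e coming from S is at most S / 2 and
   can be absorbed. Also e <= d / 2, so one of xm + e and xm - e stays in [a, b]. *)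
pose e := d / (2 * C + 2).
have e0 : 0 < e by rewrite divr_gt0//; lra.
have Ce : C * e <= d / 2.
  rewrite /e mulrCA ler_pM2l// ler_pdivrMr; lra.
have ed : e <= d / 2 by rewrite /e ler_pdivrMr; nra.
have [y yab yx] : exists2 y, a <= y <= b & `|y - xm| = e.
  have [h|h] := leP (xm + e) b.
    by exists (xm + e); [lra|rewrite addrAC subrr add0r gtr0_norm].
  exists (xm - e); first by move: h; rewrite /d in ed; lra.
  by rewrite addrAC subrr add0r normrN gtr0_norm.
have [xi [xiab xix E1]] := MVT_between df0 xmab yab.
have [et [etab etx E2]] := MVT_between df1 xiab xmab.
have h1 : `|derive1 f xi| * e <= 2 * M0.
  rewrite -yx -normrM -E1 (le_trans (ler_normB _ _))//.
  have := hf y yab; have := hf xm xmab; lra.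
have h2 : S <= `|derive1 f xi| + B * e.
  rewrite /S -[derive1 f xm](subrK (derive1 f xi)) E2 addrC.
  rewrite (le_trans (ler_normD _ _))// lerD2l normrM ler_pM//.
    exact: f2.
  by rewrite distrC -yx.
have h3 : B * e <= S / 2 + M * d ^+ m.+1 / 2.
  rewrite /B exprS.
  have -> : C * (S / d + M * d ^+ m) * e = (C * e) * (S / d + M * d ^+ m) by ring.
  have -> : S / 2 + M * (d * d ^+ m) / 2 = (d / 2) * (S / d + M * d ^+ m).
    by field; rewrite gt_eqF.
  by rewrite ler_wpM2r// addr_ge0// ?divr_ge0 ?mulr_ge0 ?exprn_ge0// ltW.
have h4 : `|derive1 f xi| <= (4 * C + 4) * (M0 / d).
  have -> : (4 * C + 4) * (M0 / d) = 2 * M0 / e.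
    by rewrite /e; field; rewrite !gt_eqF//; lra.
  by rewrite ler_pdivlMr.
move=> x xab; apply: (@le_trans _ _ S); first by apply: xmmax; rewrite in_itv.
have : 0 <= M * d ^+ m.+1 by rewrite mulr_ge0// exprn_ge0// ltW.
have : 0 <= M0 / d by rewrite divr_ge0// ltW.
set A := M0 / d in h4 *; set D := M * d ^+ m.+1 in h3 *; nra.
Qed.

Lemma derive1_lip_bound K v x : lip K v -> derivable v x 1 -> `|derive1 v x| <= K.
Proof.
move=> hv dv; rewrite derive1E /derive.
have near_bound : \forall h \near (0 : R)^', `|h^-1 *: (v (h *: 1 + x) - v x)| <= K.
  near=> h; have h0 : h != 0 by near: h; exact: nbhs_dnbhs_neq.
  rewrite normrZ normfV ler_pdivrMl ?normr_gt0//.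
  rewrite mulrC (le_trans (hv _ _))//.
  by rewrite -[X in X + x]/(h * 1) mulr1 addrK.
rewrite ler_norml; apply/andP; split.
- apply: limr_ge; first exact: dv.
  by apply: filterS near_bound => h; rewrite ler_norml => /andP[].
- apply: limr_le; first exact: dv.
  by apply: filterS near_bound => h; rewrite ler_norml => /andP[].
Unshelve. all: by end_near. Qed.

(** The slope of the chord is v'(xi) and v x - v a = v'(et) (x - a), so the error is (v'(et) -
    v'(xi)) (x - a), to which the mean value theorem applies again. Derivatives are taken only in
    the open interval because its ends may be non-regular points. *)
Lemma linear_interpolation_error v (a b M : R) : a < b ->
  {within `[a, b], continuous v} ->
  (forall z i, a < z < b -> (i <= 1)%N -> derivable (derive1n i v) z 1) ->
  (forall z, a < z < b -> `|derive1n 2 v z| <= M) ->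
  forall x, a <= x <= b ->
    `|v x - (v a + (v b - v a) / (b - a) * (x - a))| <= M * (b - a) ^+ 2.
Proof.
move=> ab cv dv hM x /andP[ax xb].
have M0 : 0 <= M.
  by apply: le_trans (hM ((a + b) / 2) _) => //; lra.
have [xi xiab E1] := MVT_open ab (fun z zab => dv z 0%N zab isT) cv.
move: ax; rewrite le_eqVlt => /predU1P[<-|ax].
  by rewrite subrr mulr0 addr0 subrr normr0 mulr_ge0// sqr_ge0.
have [| |et etax E2] := @MVT_open v a x ax.
- by move=> z zax; apply: (dv z 0%N) => //; lra.
- apply: continuous_subspaceW cv => z /=; rewrite !in_itv/=; lra.
have dv1 z : a < z < b -> derivable (derive1 v) z 1 by move=> zab; exact: (dv z 1%N).
have [th [thab _ E3]] : exists th,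
    [/\ Num.min xi et <= th <= Num.max xi et, `|th - xi| <= `|et - xi| &
      derive1 v et - derive1 v xi = derive1 (derive1 v) th * (et - xi)].
  apply: MVT_between.
  - move=> z; rewrite ge_min le_max => /andP[h1 h2]; apply: dv1.
    by case/orP: h1; case/orP: h2; lra.
  - by rewrite ge_min le_max !lexx.
  - by rewrite ge_min le_max !lexx !orbT.
rewrite E1 mulfK; last by rewrite subr_eq0 gt_eqF.
rewrite opprD addrA E2 -mulrBl E3 normrM normrM expr2 mulrA.
apply: ler_pM => //; last by rewrite ger0_norm; lra.
apply: ler_pM => //.
- apply: (hM th); move: thab; rewrite ge_min le_max => /andP[h1 h2].
  by case/orP: h1; case/orP: h2; lra.
- by rewrite ler_norml; lra.
Qed.

End DerivativeBounds.

(** * Non-regular points and essential bounds of periodic functions *)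

Section PeriodicRegularity.
Context {R : realType}.
Implicit Types (v : R -> R).
Local Notation mu := (@lebesgue_measure R).

Lemma card_le_seq (A : set R) p : (A #<= `I_p)%card ->
  exists2 r : seq R, size r = p & forall x, A x -> x \in r.
Proof.
move=> /pcard_surjP[f sf]; exists (map f (iota 0 p)); first by rewrite size_map size_iota.
move=> x /sf[i ip <-]; apply: map_f.
by rewrite mem_iota.
Qed.

Lemma derive1n_shift v a n x :
  derive1n n (fun y => v (y + a)) x = derive1n n v (x + a).
Proof.
elim: n x => [//|n IH] x; rewrite !derive1nS /derive1.
rewrite (funext IH : derive1n n _ = _).
by under eq_fun do rewrite -addrA.
Qed.

Lemma derive1n_periodic v n : periodic v 1 -> periodic (derive1n n v) 1.
Proof.
move=> pv x; rewrite -derive1n_shift; congr (derive1n n _ x).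
by apply/funext => y; rewrite pv.
Qed.

Lemma nbhs_shift (P : set R) (x a : R) :
  nbhs x P -> nbhs (x + a) (fun y => P (y - a)).
Proof.
move=> /nbhs_ballP[e e0 he]; apply/nbhs_ballP; exists e => // y hy; apply: he.
by move: hy; rewrite /ball/= (_ : x + a - y = x - (y - a))//; ring.
Qed.

Lemma derivable_periodicz v n x : periodic v 1 ->
  derivable v x 1 -> derivable v (x + n%:~R) 1.
Proof.
move=> pv; rewrite /derivable.
rewrite (_ : (fun h => h^-1 *: ((v \o shift (x + n%:~R)) (h *: 1) - v (x + n%:~R))) =
  (fun h => h^-1 *: ((v \o shift x) (h *: 1) - v x)))//.
by apply/funext => h /=; rewrite addrA !periodicz.
Qed.

Lemma continuous_at_periodicz v n x : periodic v 1 ->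
  {for x, continuous v} -> {for x + n%:~R, continuous v}.
Proof.
move=> pv cv; have -> : v = v \o (fun y => y - n%:~R).
  by apply/funext => y /=; rewrite -mulrNz periodicz.
apply: continuous_comp.
  by apply: cvgB; [exact: cvg_id|exact: cvg_cst].
by rewrite /= addrK.
Qed.

Lemma smooth_near_periodicz v m n x : periodic v 1 ->
  smooth_near m v x -> smooth_near m v (x + n%:~R).
Proof.
move=> pv /(@nbhs_shift _ _ n%:~R); apply: filterS => y [d cn]; split.
- move=> i im; rewrite -(subrK n%:~R y); apply: derivable_periodicz.
    exact: derive1n_periodic.
  exact: d.
- by rewrite -(subrK n%:~R y); apply: continuous_at_periodicz => //; exact: derive1n_periodic.
Qed.

(** Non-regular points are counted in [0,1), but a translate is studied on another period; y is
    moved to its representative a + fpart (y - a) in [a, a + 1). *)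
Lemma nonregular_points_seq v m p (a : R) : periodic v 1 ->
  (nonregular_points m v #<= `I_p)%card ->
  exists2 r : seq R, size r = p &
    forall x, a <= x < a + 1 -> x \notin r -> smooth_near m v x.
Proof.
move=> pv /card_le_seq[r sr hr].
exists [seq a + fpart (y - a) | y <- r]; first by rewrite size_map.
move=> x xa xr; apply: contrapT => nsx; move/negP: xr; apply.
have /hr xr : nonregular_points m v (fpart x).
  split; first exact: fpartP.
  move=> /(smooth_near_periodicz (Num.floor x) pv).
  by rewrite /fpart subrK.
apply/mapP; exists (fpart x) => //.
have -> : fpart (fpart x - a) = fpart (x - a).
  rewrite {2}/fpart addrAC -mulrNz.
  by rewrite (periodicz _ _ fpart_periodic).
by rewrite fpart_id; [ring|lra].
Qed.

(** If the bound failed at a point of continuity, it would fail on an interval of positive measure.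
    The interval is taken to the right of the fractional part, which may be 0, and is cut at 1 to
    stay inside (0,1). *)
Lemma Lnorm01y_le v (M : R) x : periodic v 1 -> (Lnorm01 +oo v <= M%:E)%E ->
  {for x, continuous v} -> `|v x| <= M.
Proof.
move=> pv; rewrite /Lnorm01 unlock.
have -> : (0 < mu [set: R])%E.
  by rewrite -set_itvNyy lebesgue_measure_itv/= addye// ltry.
move=> /ess_supP[N [mN N0 hN]] cvx.
rewrite leNgt; apply/negP => Mvx.
have cf : {for fpart x, continuous v}.
  by rewrite /fpart -mulrNz; exact: continuous_at_periodicz.
have {}Mvx : M < `|v (fpart x)| by rewrite periodic_fpart.
have /andP[f0 f1] := fpartP x; set y := fpart x in cf Mvx f0 f1.
have /nbhs_ballP[e e0 he] : \forall z \near y, M < `|v z|.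
  have cnv : (fun z => `|v z|) @ y --> `|v y| by apply: cvg_norm; exact: cf.
  exact: (cvgr_gt _ cnv).
pose b := Num.min (y + e) 1.
have yb : y < b by rewrite lt_min ltrDl e0.
suff : (mu `]y, b[%classic <= mu N)%E.
  by rewrite N0 lebesgue_measure_itv/= lte_fin yb -EFinD lee_fin leNgt subr_gt0 yb.
apply: le_measure; rewrite ?inE//.
move=> z; rewrite /= in_itv/= lt_min => /andP[yz /andP[ze z1]].
apply: hN => /=; rewrite patchE mem_set/=; last by rewrite in_itv/= z1 (le_lt_trans f0).
apply/negP; rewrite lee_fin -ltNge; apply: he.
by rewrite /ball/= ltr0_norm; lra.
Qed.

End PeriodicRegularity.

(** * Piecewise constant and piecewise linear approximation in V_h *)

Section Approximation.
Context {R : realType}.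
Implicit Types (v V E : R -> R).
Local Notation mu := (@lebesgue_measure R).

(** The Landau-Kolmogorov inequality is applied to v', which K bounds. As the interval has length at
    most 1, the term in c0 is also at most c0 / (be - al). *)
Lemma second_derivative_bound (l : nat) : exists2 C : R, 0 <= C &
  forall v (K c0 al be : R), 0 <= K -> 0 <= c0 -> al < be <= al + 1 -> lip K v ->
  (forall x, al < x < be -> smooth_near l.+2 v x) ->
  (forall x, al < x < be -> `|derive1n l.+2 v x| <= c0) ->
  forall x, al < x < be -> `|derive1n 2 v x| <= C * (K + c0) / (be - al).
Proof.
have [C C0 HC] := @landau_kolmogorov R l.
exists (2 * C); first by rewrite mulr_ge0.
move=> v K c0 al be K0 c00 /andP[ab b1] hv sm bd x /andP[ax xb].
(* Regularity is known in the open interval only, so a closed subinterval containing x is used; its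
   length is at least (be - al) / 2, whence the factor 2 in the constant. *)
pose a := Num.min x (al + (be - al) / 4).
pose b := Num.max x (be - (be - al) / 4).
have [ala ax'] : al < a /\ a <= x.
  by rewrite /a lt_min ge_min lexx ax/=; split => //; lra.
have [bbe xb'] : b < be /\ x <= b.
  by rewrite /b gt_max le_max lexx xb/=; split => //; lra.
have a4 : a <= al + (be - al) / 4 by rewrite /a ge_min lexx orbT.
have b4 : be - (be - al) / 4 <= b by rewrite /b le_max lexx orbT.
have dv y i : al < y < be -> (i < l.+2)%N -> derivable (derive1n i v) y 1.
  by move=> /sm /nbhs_singleton[/(_ i)].
have d0 : 0 < be - al by lra.
have d0' : 0 < b - a by lra.
have h : `|derive1n 2 v x| <= C * (K / (b - a) + c0 * (b - a) ^+ l).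
  apply: (HC (derive1 v)) => //; first by lra.
  - move=> y i yab il; rewrite derive1n_derive1; apply: dv => //; lra.
  - move=> y yab; apply: derive1_lip_bound hv _; apply: (dv y 0%N) => //; lra.
  - by move=> y yab; rewrite derive1n_derive1; apply: bd; lra.
  - by rewrite ax'.
apply: (le_trans h); rewrite [2 * C]mulrC -!mulrA ler_wpM2l//.
have h1 : K / (b - a) <= 2 * K / (be - al).
  by rewrite ler_pdivrMr// mulrAC ler_pdivlMr//; nra.
have h2 : c0 * (b - a) ^+ l <= c0 / (be - al).
  rewrite ler_wpM2l// (@le_trans _ _ 1)//.
    by rewrite exprn_ile1//; lra.
  by rewrite invf_ge1//; lra.
have h3 : 0 <= c0 / (be - al) by rewrite divr_ge0// ltW.
by rewrite [leRHS](_ : _ = 2 * K / (be - al) + 2 * (c0 / (be - al))); [lra|ring].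
Qed.

Lemma integral_le_cst E (q a b : R) : measurable_fun setT E ->
  (forall x, 0 <= E x) -> a <= b -> (forall x, a < x < b -> E x <= q) ->
  (\int[mu]_(x in `]a, b[) (E x)%:E <= (q * (b - a))%:E)%E.
Proof.
move=> mE E0 ab hE.
apply: (@le_trans _ _ (\int[mu]_(x in `]a, b[) (cst q%:E) x)%E).
  apply: ge0_le_integral => //=.
  - by move=> x _; rewrite lee_fin.
  - by apply/measurable_funTS/measurable_EFinP.
rewrite integral_cst//= lebesgue_measure_itv/= lte_fin.
move: ab; rewrite le_eqVlt => /predU1P[->|ab]; first by rewrite ltxx subrr mule0 mulr0.
by rewrite ab -EFinD -EFinM.
Qed.

(* Splitting at the points of r leaves at most size r + 1 intervals. *)
Lemma integral_splitting_bound E (r : seq R) (Q : R) :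
  measurable_fun setT E -> (forall x, 0 <= E x) -> 0 <= Q ->
  (forall al be : R, 0 <= al -> al < be -> be <= 1 ->
     (forall x : R, al < x < be -> x \notin r) ->
     (\int[mu]_(x in `]al, be[) (E x)%:E <= Q%:E)%E) ->
  (\int[mu]_(x in `]0%R, 1%R[) (E x)%:E <= ((size r).+1%:R * Q)%:E)%E.
Proof.
move=> mE E0 Q0 base.
suff H n (al be : R) : 0 <= al -> al <= be -> be <= 1 ->
    (count (fun x => al < x < be)%R r <= n)%N ->
    (\int[mu]_(x in `]al, be[) (E x)%:E <= (n.+1%:R * Q)%:E)%E.
  by apply: H => //; exact: count_size.
elim/ltn_ind: n al be => n IH al be al0 albe be1 hc.
have [/hasP[t tr /andP[at_ tb]]|/hasPn nobad] := boolP (has (fun x => al < x < be) r); last first.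
  move: albe; rewrite le_eqVlt => /predU1P[->|ab].
    by rewrite set_itvoo0 integral_set0 lee_fin mulr_ge0.
  apply: le_trans (base al be al0 ab be1 _) _.
    by move=> x xab; apply/negP => /nobad; rewrite xab.
  by rewrite lee_fin ler_peMl// ler1n.
(* The splitting point t is counted in neither half, so c1 + c2 + 1 <= n; this is what makes (c1 +
   1) + (c2 + 1) at most n + 1. *)
have hcount : (count (fun x => al < x < t)%R r + count (fun x => t < x < be)%R r +
    count (pred1 t) r <= count (fun x => al < x < be)%R r)%N.
  elim: (r) => //= y r' IHr.
  rewrite [X in (X + _ <= _)%N]addnACA addnACA; apply: leq_add => //.
  have [yt|ty|->] := ltgtP y t.
  - by rewrite (lt_trans yt tb) /= !andbT !addn0.
  - by rewrite (lt_trans at_ ty) /= addn0.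
  - by rewrite at_ tb /= ?andbF.
have ct : (0 < count (pred1 t) r)%N by rewrite -has_count has_pred1.
set c1 := count _ r in hcount; set c2 := count (fun x => t < x < be) r in hcount.
rewrite (@integral_split _ E al t be)//; last by rewrite !ltW.
have c1n : (c1 < n)%N.
  by apply: leq_trans hc; apply: leq_trans hcount; rewrite -addn1 leq_add// leq_addr.
have c2n : (c2 < n)%N.
  by apply: leq_trans hc; apply: leq_trans hcount; rewrite -addn1 leq_add// leq_addl.
have c12n : (c1 + c2 < n)%N.
  by apply: leq_trans hc; apply: leq_trans hcount; rewrite -addn1 leq_add.
have i1 : (\int[mu]_(x in `]al, t[) (E x)%:E <= (c1.+1%:R * Q)%:E)%E.
  by apply: IH (leqnn _) => //; lra.
have i2 : (\int[mu]_(x in `]t, be[) (E x)%:E <= (c2.+1%:R * Q)%:E)%E.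
  by apply: IH (leqnn _) => //; lra.
apply: le_trans (leeD i1 i2) _.
rewrite -EFinD lee_fin -mulrDl ler_wpM2r// -natrD ler_nat; lia.
Qed.

Variables (s : seq R) (hs : itv_partition 0 1 s).
Let h := mesh_size s.

(** On each cell the value at the left mesh point is taken; the error is then at most K h
    everywhere. *)
Lemma constant_approximation k V K : 0 <= K -> periodic V 1 -> lip K V ->
  exists2 z, Vh k s z & L2 (V \- z) <= K * h.
Proof.
move=> K0 pV hV.
have [|z Vz hz] := @Vh_cellwise R s hs k (fun j => (V (mesh_left s j))%:P).
  by move=> j; rewrite (leq_trans (size_polyC_leq1 _)).
exists z => //.
have nV := bperiodic_lip pV hV; have nz := bperiodic_Vh hs Vz; have nd := bperiodic_sub nV nz.
have h0 : 0 <= h := ltW (mesh_size_gt0 hs).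
have Kh0 : 0 <= K * h by exact: mulr_ge0.
rewrite -[leRHS]ger0_norm// -sqrtr_sqr.
apply: ler_wsqrtr; rewrite -lee_fin -int01_EFin; last exact: bperiodic_mul.
apply: le_trans (integral_le_cst (q := (K * h) ^+ 2) _ _ ler01 _) _.
- by case: (bperiodic_mul nd nd).
- by move=> x; rewrite /= -expr2 sqr_ge0.
- move=> x /andP[x0 x1]; have [|cs cx] := @cell_ofP R s hs x; first by rewrite ltW.
  rewrite /= (hz _ _ cs cx) hornerC -expr2 -[leLHS]real_normK ?num_real//.
  rewrite lerXn2r ?nnegrE// (le_trans (hV _ _))// ler_wpM2l//.
  have := cell_le_mesh_size cs; rewrite -/h.
  by move: cx => /andP[lx xr]; rewrite ger0_norm; lra.
- by rewrite lee_fin subr0 mulr1.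
Qed.

(* On an interval ]al, be[ without exceptional points, |V - z|^2 is at most
   the product of the Lipschitz bound 2 K h and the second-order bound
   M h^2 / (be - al); hence its integral is O(h^3) however short the interval
   is. Cells sticking out of ]al, be[ lie within h of its ends, where the
   Lipschitz bound alone suffices. *)
Lemma piecewise_linear_approximation k V (r : seq R) K M : (1 <= k)%N ->
  0 <= K -> 0 <= M -> periodic V 1 -> lip K V ->
  (forall al be : R, 0 <= al -> al < be -> be <= 1 ->
     (forall x : R, al < x < be -> x \notin r) ->
     forall a b x, al <= a -> a < b -> b <= be -> a <= x <= b ->
     `|V x - (V a + (V b - V a) / (b - a) * (x - a))| <=
       M / (be - al) * (b - a) ^+ 2) ->
  exists2 z, Vh k s z &
    L2 (V \- z) <= Num.sqrt ((size r).+1%:R * (2 * K * M + 8 * K ^+ 2)) *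
      h `^ (3%:R / 2%:R).
Proof.
move=> k1 K0 M0 pV hV hM.
pose A j := mesh_left s j; pose B j := mesh_right s j.
pose P j := (V (A j))%:P + ((V (B j) - V (A j)) / (B j - A j)) *: ('X - (A j)%:P).
have PE j x : (P j).[x] = V (A j) + (V (B j) - V (A j)) / (B j - A j) * (x - A j).
  by rewrite /P !hornerE.
have [|z Vz hz] := @Vh_cellwise R s hs k P.
  move=> j; apply: (leq_trans (size_polyD _ _)).
  rewrite geq_max (leq_trans (size_polyC_leq1 _))//=.
  by rewrite (leq_trans (size_scale_leq _ _))// size_XsubC.
exists z => //.
have nV := bperiodic_lip pV hV; have nz := bperiodic_Vh hs Vz; have nd := bperiodic_sub nV nz.
have [_ mE _] := bperiodic_mul nd nd.
set E := _ \* _ in mE.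
have E0 x : 0 <= E x by rewrite /E /= -expr2 sqr_ge0.
have h0 : 0 < h := mesh_size_gt0 hs.
have Dz x : 0 <= x < 1 -> exists j, [/\ (j < size s)%N, A j <= x < B j &
    V x - z x = V x - (V (A j) + (V (B j) - V (A j)) / (B j - A j) * (x - A j))].
  move=> /(cell_ofP hs)[cs cx]; exists (cell_of s x); split=> //.
  by rewrite (hz _ _ cs cx) PE.
have coarse x : 0 <= x < 1 -> `|V x - z x| <= 2 * K * h.
  move=> /Dz[j [js /andP[ax xb] ->]].
  have w := cell_le_mesh_size js; rewrite -/h -/(A j) -/(B j) in w.
  rewrite [leRHS](_ : _ = K * h + K * h); last by ring.
  rewrite opprD addrA (le_trans (ler_normB _ _))// lerD//.
    by rewrite (le_trans (hV _ _))// ler_wpM2l// ger0_norm; lra.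
  have AB : 0 < B j - A j by lra.
  rewrite normrM normrM normfV (gtr0_norm AB) (ger0_norm (_ : 0 <= x - A j)); last by lra.
  rewrite mulrAC ler_pdivrMr// (le_trans (ler_wpM2r _ (hV _ _)))//; first by lra.
  by rewrite (gtr0_norm AB) mulrAC ler_wpM2r ?ler_wpM2l//; lra.
rewrite -[leRHS]ger0_norm ?mulr_ge0 ?sqrtr_ge0 ?powR_ge0// -sqrtr_sqr.
apply: ler_wsqrtr; rewrite -lee_fin -int01_EFin; last exact: bperiodic_mul.
have -> : (Num.sqrt ((size r).+1%:R * (2 * K * M + 8 * K ^+ 2)) * h `^ (3%:R / 2%:R)) ^+ 2 =
   (size r).+1%:R * ((2 * K * M + 8 * K ^+ 2) * h ^+ 3).
  rewrite exprMn sqr_sqrtr; last by rewrite mulr_ge0// addr_ge0 ?mulr_ge0 ?sqr_ge0.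
  rewrite -[(h `^ _) ^+ 2]powR_mulrn ?powR_ge0// -powRrM.
  by rewrite (_ : 3%:R / 2%:R * 2%:R = 3%:R) ?powR_mulrn ?mulrA// ?ltW//; field.
apply: integral_splitting_bound => //.
  by rewrite mulr_ge0 ?exprn_ge0 ?addr_ge0 ?mulr_ge0 ?sqr_ge0// ltW.
move=> al be al0 ab be1 nobad.
(* The two strips of width at most h contribute (2 K h)^2 h each and the middle 2 K M h^3. The
   minimum and the maximum keep al <= al' <= be' <= be when the interval is shorter than 2 h. *)
pose al' := Num.min (al + h) be; pose be' := Num.max al' (be - h).
have [ala al'b] : al <= al' /\ al' <= be.
  by rewrite /al' le_min ge_min lexx orbT; split => //; apply/andP; split; lra.
have al'h : al' <= al + h by rewrite /al' ge_min lexx.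
have [a'b' b'b] : al' <= be' /\ be' <= be.
  by rewrite /be' le_max lexx ge_max al'b/=; split => //; lra.
have bb'h : be - h <= be' by rewrite /be' le_max lexx orbT.
have Ecoarse x : al < x < be -> E x <= 4 * K ^+ 2 * h ^+ 2.
  move=> xab; have := coarse x; rewrite ler_norml /E /= => /(_ _)/andP[]; first by lra.
  by move=> ? ?; nra.
have i1 := @integral_le_cst E (4 * K ^+ 2 * h ^+ 2) al al' mE E0 ala _.
have i3 := @integral_le_cst E (4 * K ^+ 2 * h ^+ 2) be' be mE E0 b'b _.
have i2 := @integral_le_cst E (2 * K * M * h ^+ 3 / (be - al)) al' be' mE E0 a'b' _.
rewrite (@integral_split _ E al al' be)//; last by rewrite ala.
rewrite (@integral_split _ E al' be' be)//; last by rewrite a'b'.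
apply: le_trans (leeD (i1 _) (leeD (i2 _) (i3 _))) _.
- by move=> x xx; apply: Ecoarse; lra.
(* Such an x is more than h away from al and be, so its whole cell lies in ]al, be[ and the
   second-order bound applies. *)
- move=> x /andP[al'x xbe'].
  have xa : al + h < x.
    move: al'x; rewrite /al' gt_min => /orP[//|]; lra.
  have xb : x < be - h.
    by move: xbe'; rewrite /be' lt_max => /orP[|//]; lra.
  have x01 : 0 <= x < 1 by lra.
  have [j [js /andP[ax xb'] Ez]] := Dz x x01.
  have w := cell_le_mesh_size js; rewrite -/h -/(A j) -/(B j) in w.
  have fine_ := hM al be al0 ab be1 nobad (A j) (B j) x.
  rewrite -Ez in fine_; have c1 := coarse x x01.
  have f1 : `|V x - z x| <= M / (be - al) * h ^+ 2.
    apply: (le_trans (fine_ _ _ _ _)); [lra..|].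
    rewrite ler_wpM2l ?divr_ge0//; first by lra.
    by rewrite lerXn2r ?nnegrE//; lra.
  rewrite /E /= -expr2 -[leLHS]real_normK ?num_real// expr2.
  have -> : 2 * K * M * h ^+ 3 / (be - al) = (2 * K * h) * (M / (be - al) * h ^+ 2).
    by rewrite !exprS; ring.
  exact: ler_pM.
- by move=> x xx; apply: Ecoarse; lra.
rewrite -!EFinD lee_fin.
have e1 : 4 * K ^+ 2 * h ^+ 2 * (al' - al) <= 4 * K ^+ 2 * h ^+ 3.
  rewrite [h ^+ 3]exprSr [leRHS]mulrA ler_wpM2l ?mulr_ge0 ?sqr_ge0//; lra.
have e3 : 4 * K ^+ 2 * h ^+ 2 * (be - be') <= 4 * K ^+ 2 * h ^+ 3.
  rewrite [h ^+ 3]exprSr [leRHS]mulrA ler_wpM2l ?mulr_ge0 ?sqr_ge0//; lra.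
have e2 : 2 * K * M * h ^+ 3 / (be - al) * (be' - al') <= 2 * K * M * h ^+ 3.
  rewrite mulrAC ler_pdivrMr ?subr_gt0//; apply: ler_wpM2l; last by lra.
  by apply: mulr_ge0; [rewrite !mulr_ge0|rewrite exprn_ge0// ltW].
lra.
Qed.

End Approximation.

(** * Approximation of the class C^(l+1)_{p,L,c0} *)

Section ClassApproximation.
Context {R : realType}.

(** The constant precedes v, the mesh and the translation, so it serves all time levels at once.
    Constants suffice for rate 1, when k or l is 0; otherwise linear interpolation gives rate
    3/2. *)
Lemma piecewise_C_approximation (k l p : nat) (L c0 K : R) : 0 <= K ->
  exists2 C : R, 0 <= C & forall (v : R -> R) (s : seq R) (tau : R),
    itv_partition 0 1 s -> piecewise_C l.+1 p L c0 v -> lip K v ->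
    exists2 z, Vh k s z &
      L2 ((fun x => v (x - tau)) \- z) <= C * mesh_size s `^ rate R k l.
Proof.
move=> K0; have [kl0|kl0] := posnP (minn k l).
  exists K => // v s tau hs [pv _ _ _ _] hv.
  have r1 : rate R k l = 1.
    by rewrite /rate kl0; apply/min_idPl; rewrite ler_pdivlMr ?mul1r ?ler_nat.
  rewrite r1 powRr1; last exact: ltW (mesh_size_gt0 hs).
  apply: constant_approximation => //; last exact: lip_shift.
  by move=> x; rewrite addrAC pv.
have k1 : (1 <= k)%N by lia.
have [l' lE] : exists l', l = l'.+1 by exists l.-1; lia.
have rE : rate R k l = 3%:R / 2%:R.
  rewrite /rate; apply/min_idPr; rewrite ler_pdivrMr//.
  have : (2%:R : R) <= (minn k l).+1%:R by rewrite ler_nat.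
  lra.
have [C1 C10 HC1] := @second_derivative_bound R l'.
pose M := C1 * (K + `|c0|).
have M0 : 0 <= M by rewrite mulr_ge0// addr_ge0.
exists (Num.sqrt (p.+1%:R * (2 * K * M + 8 * K ^+ 2))); first exact: sqrtr_ge0.
move=> v s tau hs [pv _ _ hc0 hbad] hv.
(* On (0,1) the translate by tau sees v on ]-tau, 1 - tau[, so the non-regular points are listed in
   that period. *)
have [r sr hr] := nonregular_points_seq (- tau) pv hbad.
rewrite rE -sr -(size_map (fun x => x + tau) r).
apply: piecewise_linear_approximation => //.
- by move=> x; rewrite addrAC pv.
- exact: lip_shift.
move=> al be al0 ab be1 nobad a b x ala aB bbe /andP[ax xb].
have sm y : al - tau < y < be - tau -> smooth_near l.+1 v y.
  move=> yab; apply: hr; first by lra.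
  have : y + tau \notin [seq x + tau | x <- r] by apply: nobad; lra.
  by apply: contra; exact: (map_f (fun x => x + tau)).
have top y : al - tau < y < be - tau -> `|derive1n l.+1 v y| <= `|c0|.
  move=> /sm /nbhs_singleton[_ cy]; apply: le_trans (ler_norm c0).
  by apply: Lnorm01y_le => //; exact: derive1n_periodic.
rewrite lE in sm top.
have d2 y : al - tau < y < be - tau -> `|derive1n 2 v y| <= M / (be - al).
  move=> yab; rewrite (_ : be - al = (be - tau) - (al - tau)); last by ring.
  by apply: HC1 => //; lra.
rewrite (_ : b - a = (b - tau) - (a - tau)); last by ring.
rewrite (_ : x - a = (x - tau) - (a - tau)); last by ring.
apply: linear_interpolation_error.
- by lra.
- by apply: continuous_subspaceT => y; exact: lip_continuous hv y.
- move=> y i yab i1; have /sm/nbhs_singleton[dy _] : al - tau < y < be - tau by lra.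
  by apply: dy; exact: leq_ltn_trans i1 _.
- by move=> y yab; apply: d2; lra.
- by lra.
Qed.

End ClassApproximation.

(** * Running maximum versus maximum of the end values *)

Section EndpointMax.
Context {R : realType}.
Local Notation mu := (@lebesgue_measure R).
Implicit Types (g E : R -> R).

(** Near y, g'(y) = 0 and differentiability of g' at y give |g'(xi)| <= (|D| + 1) |xi - y|, then the
    mean value theorem applies. Beyond distance e the Lipschitz bound K |x - y| is at most (K / e)
    (x - y)^2, so the estimate is global and dt need not be small. *)
Lemma local_maximum_quadratic g K y : 0 <= K -> lip K g ->
  local_maximum g y -> twice_differentiable_at g y ->
  exists2 B, 0 <= B & forall x, g y - g x <= B * (x - y) ^+ 2.
Proof.
move=> K0 hg ymax [dg ddg].
have [e1 /= e10 he1] : \forall z \near y, g z <= g y /\ derivable g z 1.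
  by near=> z; split; near: z.
have {}he1 t : y - e1 < t < y + e1 -> g t <= g y /\ derivable g t 1.
  by move=> ht; apply: he1; rewrite /ball_/= ltr_norml; lra.
have g'y : derive1 g y = 0.
  have := @derive1_at_max R g (y - e1) (y + e1) y.
  rewrite derive1E; case => //.
  - by lra.
  - by move=> t; rewrite in_itv/= => /he1[].
  - by rewrite in_itv/=; lra.
  - by move=> t; rewrite in_itv/= => /he1[].
pose D := 'D_1 (derive1 g) y.
have [e2 /= e20 he2] : \forall h \near (0 : R)^',
    `|h^-1 *: (derive1 g (h *: 1 + y) - derive1 g y)| < `|D| + 1.
  have cv : (fun h => `|h^-1 *: (derive1 g (h *: 1 + y) - derive1 g y)|) @ (0 : R)^' --> `|D|.
    by apply: cvg_norm; exact: ddg.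
  by apply: (cvgr_lt _ cv); rewrite ltrDl.
pose e := Num.min e1 e2 / 2.
have e0 : 0 < e by rewrite divr_gt0// lt_min e10.
have ee1 : e < e1 by rewrite /e ltr_pdivrMr// (@le_lt_trans _ _ e1) ?ge_min ?lexx//; lra.
have ee2 : e < e2 by rewrite /e ltr_pdivrMr// (@le_lt_trans _ _ e2) ?ge_min ?lexx ?orbT//; lra.
exists (`|D| + 1 + K / e); first by rewrite !addr_ge0// divr_ge0// ltW.
move=> x; rewrite mulrDl.
have Ke0 : 0 <= K / e by rewrite divr_ge0// ltW.
have [xe|ex] := leP `|x - y| e.
  have [|||xi [xiab xix E1]] := @MVT_between R g (y - e) (y + e) y x.
  - by move=> z zab; have [] : g z <= g y /\ derivable g z 1 by apply: he1; lra.
  - by lra.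
  - by move: xe; rewrite ler_norml; lra.
  have g'xi : `|derive1 g xi| <= (`|D| + 1) * `|x - y|.
    have [->|xiy] := eqVneq xi y.
      by rewrite g'y normr0 mulr_ge0// addr_ge0.
    have h0 : xi - y != 0 by rewrite subr_eq0.
    have := he2 (xi - y).
    rewrite /ball_ /= sub0r normrN => /(_ (le_lt_trans (le_trans xix xe) ee2) h0)/ltW.
    rewrite [X in X + y](_ : _ = xi - y); last by rewrite /GRing.scale/= mulr1.
    rewrite subrK g'y subr0 normrZ normfV ler_pdivrMl ?normr_gt0// => h.
    by apply: (le_trans h); rewrite [leLHS]mulrC; apply: ler_wpM2l => //; exact: addr_ge0.
  have h1 : g y - g x <= (`|D| + 1) * (x - y) ^+ 2.
    rewrite -opprB E1 (le_trans (ler_norm _))// normrN normrM.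
    by rewrite -[(x - y) ^+ 2]real_normK ?num_real// expr2 mulrA ler_wpM2r.
  by rewrite (le_trans h1)// lerDl mulr_ge0// sqr_ge0.
have h1 : g y - g x <= K * `|x - y|.
  by rewrite distrC (le_trans (ler_norm _)).
rewrite (le_trans h1)// ler_wpDl//; first by rewrite mulr_ge0 ?sqr_ge0 ?addr_ge0.
rewrite -[(x - y) ^+ 2]real_normK ?num_real// expr2 mulrA ler_wpM2r//.
by rewrite mulrAC ler_pdivlMr// ler_wpM2l// ltW.
Unshelve. all: by end_near. Qed.

Lemma local_maximum_fpart g y : periodic g 1 ->
  local_maximum g y -> local_maximum g (fpart y).
Proof.
move=> pg; rewrite /fpart -mulrNz => /(@nbhs_shift _ _ _ (- Num.floor y)%:~R).
by apply: filterS => z /=; rewrite -mulrNz !periodicz.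
Qed.

(** Summing the indicators of the windows ]t, t + d[, rather than taking that of their union, allows
    the windows to overlap. *)
Lemma integral_le_cover E (W d : R) (r : seq R) : 0 <= W -> 0 <= d ->
  measurable_fun setT E -> (forall x, 0 <= E x) ->
  (forall x, 0 < x < 1 -> E x <= \sum_(t <- r) W * \1_(`]t, t + d[%classic) x) ->
  (\int[mu]_(x in `]0%R, 1%R[) (E x)%:E <= ((size r)%:R * (W * d))%:E)%E.
Proof.
move=> W0 d0 mE E0 hE.
have m1 t (D : set R) : measurable_fun D (fun x : R => \1_(`]t, t + d[%classic) x : R).
  by apply: measurable_indic; exact: measurable_itv.
have mt t (D : set R) : measurable_fun D (fun x : R => (W * \1_(`]t, t + d[%classic) x)%:E).
  by apply: measurableT_comp => //; exact: measurable_funM.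
apply: (@le_trans _ _ (\int[mu]_(x in `]0%R, 1%R[)
    \sum_(t <- r) (W * \1_(`]t, t + d[%classic) x)%:E)%E).
  apply: ge0_le_integral => //=.
  - by move=> x _; rewrite lee_fin.
  - by apply/measurable_funTS/measurable_EFinP.
  - by apply: emeasurable_sum => t; exact: mt.
  - by move=> x; rewrite in_itv/= => /hE; rewrite sumEFin lee_fin.
rewrite ge0_integral_sum//; last 2 first.
- by move=> t; exact: mt.
- by move=> t x _; rewrite lee_fin mulr_ge0.
apply: (@le_trans _ _ (\sum_(t <- r) (W * d)%:E)%E).
  apply: lee_sum => t _; under eq_integral do rewrite EFinM.
  rewrite ge0_integralZl ?lee_fin//=; last first.
    by apply: measurableT_comp => //; exact: m1.
  rewrite EFinM lee_wpmul2l// integral_indic//.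
  apply: (@le_trans _ _ (mu `]t, t + d[%classic)); first exact: measureIl.
  rewrite lebesgue_measure_itv/= lte_fin; case: ifP => _; last by rewrite lee_fin.
  by rewrite -EFinD lee_fin addrAC subrr add0r.
by rewrite sumEFin lee_fin big_const_seq count_predT iter_addr_0 mulr_natl.
Qed.

(** The order dt^(5/2) is written as dt^(3/2) times dt because the error estimate divides by dt. *)
Lemma endpoint_max_error (c : R) g q : 0 < c -> periodic g 1 -> lipschitz g ->
  Delta2 q g -> exists2 C : R, 0 <= C & forall dt : R, 0 < dt ->
    L2 (endpoint_max c g dt \- running_max c g dt) <= C * dt `^ (3%:R / 2%:R) * dt.
Proof.
move=> c0 pg /lipschitz_lip[K K0 hg] [/card_le_seq[r sr hr] hd2].
(* One constant for all local maxima: up to periods they belong to the finite list r, and the sum of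
   the constants over r dominates each of them. *)
have [B B0 hB] : exists2 B, 0 <= B &
    forall y, local_maximum g y -> forall x, g y - g x <= B * (x - y) ^+ 2.
  have /choice[b hb] : forall y, exists B, 0 <= B /\ (local_maximum g y ->
      forall x, g y - g x <= B * (x - y) ^+ 2).
    move=> y; have [ymax|ny] := pselect (local_maximum g y); last by exists 0; split.
    have [B B0 hB] := local_maximum_quadratic K0 hg ymax (hd2 _ ymax).
    by exists B.
  exists (\sum_(y <- r) b y); first by apply: sumr_ge0 => y _; have [] := hb y.
  move=> y ymax x; have fmax := local_maximum_fpart pg ymax.
  have fr : fpart y \in r by apply: hr; split; [exact: fpartP|].
  have := (hb (fpart y)).2 fmax (x - (Num.floor y)%:~R).
  rewrite periodic_fpart// -[in g (x - _)]mulrNz periodicz//.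
  rewrite [X in X ^+ 2](_ : _ = x - y); last by rewrite /fpart; ring.
  move=> h; apply: (le_trans h); rewrite ler_wpM2r ?sqr_ge0//.
  rewrite (perm_big _ (perm_to_rem fr)) big_cons lerDl.
  by apply: sumr_ge0 => z _; have [] := hb z.
have cg := lip_continuous hg.
(* If the running maximum exceeds both end values, its maximiser th is neither 0 nor dt; then x - c
   th maximises g over ]x - c dt, x[ and is a local maximum at distance c th < c dt from x. *)
have key dt x : 0 < dt -> endpoint_max c g dt x - running_max c g dt x = 0 \/
    (`|endpoint_max c g dt x - running_max c g dt x| <= B * (c * dt) ^+ 2 /\
     exists y, local_maximum g y /\ x - c * dt < y < x).
  move=> dt0; have [th [tht E h]] := running_max_attained c cg x (ltW dt0).
  have h0 := h 0; have hdt := h dt; rewrite mulr0 subr0 in h0.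
  have le_er : endpoint_max c g dt x <= running_max c g dt x.
    by rewrite /endpoint_max ge_max h0 ?hdt//; lra.
  have [le_re|lt_er] := leP (running_max c g dt x) (endpoint_max c g dt x).
    by left; apply/eqP; rewrite subr_eq0 eq_le le_er.
  right; move: lt_er; rewrite {1}/endpoint_max gt_max E => /andP[lt1 lt2].
  have th0 : th != 0 by apply: contraTneq lt1 => ->; rewrite mulr0 subr0 ltxx.
  have thdt : th != dt by apply: contraTneq lt2 => ->; rewrite ltxx.
  have /andP[th_gt0 th_lt] : 0 < th < dt by rewrite !lt_neqAle thdt eq_sym th0.
  have cth : 0 < c * th < c * dt by rewrite mulr_gt0// ltr_pM2l.
  have ymax : local_maximum g (x - c * th).
    have : \forall z \near x - c * th, z \in `]x - c * dt, x[.
      by apply: near_in_itvoo; rewrite in_itv/=; lra.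
    apply: filterS => z; rewrite in_itv/= => zx.
    have := h ((x - z) / c); rewrite E (_ : x - c * ((x - z) / c) = z); last first.
      by field; rewrite gt_eqF.
    apply.
    by rewrite ler_pdivrMr// divr_ge0/=; lra.
  split; last by exists (x - c * th); split => //; lra.
  rewrite distrC ger0_norm; last by rewrite subr_ge0 -E.
  have := hB _ ymax x; rewrite (_ : x - (x - c * th) = c * th); last by ring.
  move=> h1.
  apply: (@le_trans _ _ (g (x - c * th) - g x)).
    by rewrite lerD2l lerN2 /endpoint_max le_max lexx.
  apply: (le_trans h1); rewrite ler_wpM2l// lerXn2r ?nnegrE//; lra.
pose C1 := B * c ^+ 2.
have C10 : 0 <= C1 by rewrite mulr_ge0// sqr_ge0.
exists (C1 * Num.sqrt ((q + q).+1%:R * c)).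
  by rewrite mulr_ge0// sqrtr_ge0.
move=> dt dt0.
have cdt0 : 0 < c * dt by rewrite mulr_gt0.
have ne : bperiodic (endpoint_max c g dt) := bperiodic_endpoint_max c pg hg dt.
have nr : bperiodic (running_max c g dt) := bperiodic_running_max c pg hg (ltW dt0).
have nd := bperiodic_sub ne nr.
pose W := (B * (c * dt) ^+ 2) ^+ 2.
have W0 : 0 <= W by exact: sqr_ge0.
(* For x in (0,1) and c dt < 1 the relevant local maxima lie in ]-1, 1[: representatives in [0,1)
   and their translates by -1 suffice. *)
pose rr := r ++ [seq y - 1 | y <- r].
have srr : size rr = (q + q)%N by rewrite size_cat size_map sr.
have [_ mE _] := bperiodic_mul nd nd.
set E := _ \* _ in mE.
have E0 x : 0 <= E x by rewrite /E /= -expr2 sqr_ge0.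
have EW x : E x <= W.
  have [E1|[E1 _]] := key dt x dt0; first by rewrite /E /= E1 mul0r.
  by rewrite /E /= -expr2 -[leLHS]real_normK ?num_real// lerXn2r ?nnegrE// mulr_ge0// sqr_ge0.
have intE : (\int[mu]_(x in `]0%R, 1%R[) (E x)%:E <= ((q + q).+1%:R * (W * (c * dt)))%:E)%E.
  (* When c dt >= 1 the windows cover a period, and the bound W on (0,1) is enough; the successor in
     [(q + q).+1] keeps the factor at least 1. *)
  have [cdt1|cdt1] := leP 1 (c * dt).
    apply: le_trans (integral_le_cst (q := W) mE E0 ler01 _) _; first by move=> x _.
    rewrite lee_fin subr0 mulr1 (@le_trans _ _ (W * (c * dt)))//.
      by rewrite ler_peMr.
    by rewrite ler_peMl ?ler1n// mulr_ge0// ltW.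
  apply: le_trans (integral_le_cover (r := rr) W0 (ltW cdt0) mE E0 _) _; last first.
    by rewrite lee_fin srr ler_wpM2r ?ler_nat// mulr_ge0// ltW.
  move=> x /andP[x0 x1].
  have sum0 (l : seq R) : 0 <= \sum_(t <- l) W * \1_(`]t, (t + c * dt)%R[%classic) x.
    by apply: sumr_ge0 => t _; rewrite mulr_ge0.
  have [E1|[_ [y [ymax yx]]]] := key dt x dt0; first by rewrite {1}/E /= E1 mul0r.
  have yrr : y \in rr.
    have fr : fpart y \in r by apply: hr; split; [exact: fpartP|exact: local_maximum_fpart].
    rewrite mem_cat; have [y0|y0] := leP 0 y.
      by rewrite -[y]fpart_id ?fr//; lra.
    apply/orP; right; apply/mapP; exists (fpart y) => //.
    by rewrite -fpart_periodic fpart_id; [ring|lra].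
  rewrite (perm_big _ (perm_to_rem yrr)) big_cons indicE mem_set/=; last by rewrite in_itv/=; lra.
  by rewrite mulr1 (le_trans (EW x))// lerDl.
have -> : C1 * Num.sqrt ((q + q).+1%:R * c) * dt `^ (3%:R / 2%:R) * dt =
    Num.sqrt ((q + q).+1%:R * (W * (c * dt))).
  have -> : (q + q).+1%:R * (W * (c * dt)) =
      ((q + q).+1%:R * c) * ((C1 * dt) ^+ 2 * dt ^+ 3).
    by rewrite /W /C1; ring.
  rewrite [in RHS]sqrtrM; last by apply: mulr_ge0; [exact: ler0n|exact: ltW].
  rewrite [in RHS](sqrtrM _ (sqr_ge0 (C1 * dt))) sqrtr_sqr (ger0_norm (mulr_ge0 C10 (ltW dt0))).
  have -> : Num.sqrt (dt ^+ 3) = dt `^ (3%:R / 2%:R).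
    by rewrite -powR12_sqrt ?exprn_ge0 ?ltW// -powR_mulrn ?ltW// -powRrM.
  by ring.
apply: ler_wsqrtr; rewrite -lee_fin -int01_EFin//; exact: bperiodic_mul.
Qed.

End EndpointMax.

(** * The error estimate with a constant independent of T, dt, the mesh and n *)

Section ErrorEstimate.
Context {R : realType}.

Lemma sldg_error (c : R) (k l p : nat) (L c0 : R) (u0 g : R -> R) : 0 < c ->
  periodic u0 1 -> periodic g 1 -> lipschitz u0 -> lipschitz g ->
  exists2 C : R, 0 <= C &
    forall (T dt : R) (s : seq R) (gt : R -> R) (uh : nat -> R -> R) (n : nat),
    0 < T -> not_shattering l p L c0 T (exact_solution c u0 g) ->
    0 < dt <= T -> itv_partition 0 1 s ->
    gt = running_max c g dt \/ gt = endpoint_max c g dt ->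
    sldg_scheme k s c dt u0 gt uh -> n%:R * dt <= T ->
    (L2norm01 (uh n \- exact_solution c u0 g (n%:R * dt))%R <=
     (C * T * (mesh_size s `^ rate R k l / dt) +
      C * T * (L2 (gt \- running_max c g dt) / dt))%:E)%E /\
    bperiodic (gt \- running_max c g dt).
Proof.
move=> hc pu pg /lipschitz_lip[Ku Ku0 hu] /lipschitz_lip[Kg Kg0 hg].
pose K := Num.max Ku Kg.
have K0 : 0 <= K by rewrite le_max Ku0.
have {}hu : lip K u0 by apply: lip_le hu; rewrite le_max lexx.
have {}hg : lip K g by apply: lip_le hg; rewrite le_max lexx orbT.
have [C C0 HC] := @piecewise_C_approximation R k l p L c0 K K0.
(* With Y = T / dt, both n <= Y and 1 <= Y hold, so 4 n + 2 <= 6 Y; the summand 1 accounts for the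
   obstacle error n G <= Y G. *)
exists (6 * C + 1); first by lra.
move=> T dt s gt uh n T0 ns /andP[dt0 dtT] hs hgt sch nT.
have nrm := bperiodic_running_max c pg hg (ltW dt0).
have ngt : bperiodic gt by case: hgt => -> //; exact: (bperiodic_endpoint_max c pg hg).
split; last exact: bperiodic_sub.
set eta := mesh_size s `^ _; set G := L2 (gt \- _).
have eta0 : 0 <= eta by exact: powR_ge0.
have G0 : 0 <= G by exact: L2_ge0.
have mdt0 m : 0 <= m%:R * dt by rewrite mulr_ge0// ltW.
have nuh : bperiodic (uh n).
  by apply: (bperiodic_Vh hs); case: (n) => [|m]; [exact: sch.1.1|have [w _ [] ] := sch.2 m; eauto].
rewrite L2norm01E; last exact: bperiodic_sub nuh (bperiodic_exact_solution c pu pg hu hg (mdt0 n)).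
rewrite lee_fin.
have := scheme_error pu pg hu hg hs dt0 ngt sch (n := n) (eta := C * eta).
move=> /(_ _)/le_trans; apply.
  move=> m tau mn; apply: HC => //; last exact: exact_solution_lip.
  apply: ns; rewrite mdt0 (le_trans _ nT)// ler_wpM2r ?ler_nat//.
  exact: ltW.
rewrite -/G; pose Y := T / dt.
have nY : n%:R <= Y by rewrite ler_pdivlMr.
have Y1 : 1 <= Y by rewrite ler_pdivlMr// mul1r.
have -> : (6 * C + 1) * T * (eta / dt) + (6 * C + 1) * T * (G / dt) =
    (6 * C + 1) * eta * Y + (6 * C + 1) * G * Y by rewrite /Y; ring.
have Ce0 : 0 <= C * eta by exact: mulr_ge0.
have Cg0 : 0 <= C * G by exact: mulr_ge0.
have Y0 : 0 <= Y by lra.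
have e1 : (4 * n%:R + 2) * (C * eta) <= 6 * Y * (C * eta).
  by rewrite ler_wpM2r//; lra.
have e2 : n%:R * G <= Y * G by rewrite ler_wpM2r.
have e3 : 0 <= Y * eta by exact: mulr_ge0.
have e4 : 0 <= Y * (C * G) by exact: mulr_ge0.
lra.
Qed.

End ErrorEstimate.

Theorem theorem4p2 (R : realType) (c : R) (k l p : nat) (L c0 : R)
    (u0 g : R -> R) (hc : 0 < c)
    (u0_periodic : periodic u0 1) (g_periodic : periodic g 1)
    (u0_lipschitz : lipschitz u0) (g_lipschitz : lipschitz g) :
  [/\ exists2 C : R, 0 <= C &
        forall (T dt : R) (s : seq R) (gt : R -> R) (uh : nat -> R -> R)
          (n : nat),
        0 < T ->
        not_shattering l p L c0 T (exact_solution c u0 g) ->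
        0 < dt <= T ->
        itv_partition 0 1 s ->
        gt = running_max c g dt \/ gt = endpoint_max c g dt ->
        sldg_scheme k s c dt u0 gt uh ->
        n%:R * dt <= T ->
        (L2norm01 (uh n \- exact_solution c u0 g (n%:R * dt))%R <=
           (C * T * (mesh_size s `^ rate R k l / dt))%:E +
           (C * T)%:E * (L2norm01 (gt \- running_max c g dt)%R
                         * (dt^-1)%:E))%E,
      exists2 C : R, 0 <= C &
        forall (T dt : R) (s : seq R) (uh : nat -> R -> R) (n : nat),
        0 < T ->
        not_shattering l p L c0 T (exact_solution c u0 g) ->
        0 < dt <= T ->
        itv_partition 0 1 s ->
        sldg_scheme k s c dt u0 (running_max c g dt) uh ->
        n%:R * dt <= T ->
        (L2norm01 (uh n \- exact_solution c u0 g (n%:R * dt))%R <=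
           (C * T * (mesh_size s `^ rate R k l / dt))%:E)%E &
      forall q : nat, (1 <= q)%N -> Delta2 q g ->
        exists2 C : R, 0 <= C &
        forall (T dt : R) (s : seq R) (uh : nat -> R -> R) (n : nat),
        0 < T ->
        not_shattering l p L c0 T (exact_solution c u0 g) ->
        0 < dt <= T ->
        itv_partition 0 1 s ->
        sldg_scheme k s c dt u0 (endpoint_max c g dt) uh ->
        n%:R * dt <= T ->
        (L2norm01 (uh n \- exact_solution c u0 g (n%:R * dt))%R <=
           (C * T * (mesh_size s `^ rate R k l / dt)
            + C * T * dt `^ (3%:R / 2%:R))%:E)%E].
Proof.
have [C C0 HC] := @sldg_error R c k l p L c0 u0 g hc u0_periodic g_periodic
  u0_lipschitz g_lipschitz.
split.
- exists C => // T dt s gt uh n T0 ns hdt hs hgt sch nT.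
  have [h nd] := HC T dt s gt uh n T0 ns hdt hs hgt sch nT.
  by rewrite (L2norm01E nd) -!EFinM -EFinD.
- exists C => // T dt s uh n T0 ns hdt hs sch nT.
  have [h nd] := HC T dt s _ uh n T0 ns hdt hs (or_introl erefl) sch nT.
  apply: le_trans h _; rewrite lee_fin gerDl.
  rewrite (_ : L2 _ = 0) ?mul0r ?mulr0//.
  rewrite /L2 (_ : _ \* _ = cst 0); last first.
    by apply/funext => x /=; rewrite subrr mul0r.
  by rewrite /int01 Rintegral_cst ?mul0r ?sqrtr0//; exact: measurable_itv.
- move=> q _ hq.
  have [B B0 HB] := endpoint_max_error hc g_periodic g_lipschitz hq.
  (* The summand C serves the mesh term, and C B the obstacle term after division by dt. *)
  exists (C + C * B); first by rewrite addr_ge0// mulr_ge0.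
  move=> T dt s uh n T0 ns hdt hs sch nT.
  have [h nd] := HC T dt s _ uh n T0 ns hdt hs (or_intror erefl) sch nT.
  apply: le_trans h _; rewrite lee_fin.
  have /andP[dt0 dtT] := hdt.
  have e1 : L2 (endpoint_max c g dt \- running_max c g dt) / dt <=
      B * dt `^ (3%:R / 2%:R) by rewrite ler_pdivrMr// HB.
  have T0' := ltW T0.
  have CT0 : 0 <= C * T by exact: mulr_ge0.
  apply: lerD.
    apply: ler_wpM2r; first by rewrite divr_ge0 ?powR_ge0// ltW.
    by rewrite ler_wpM2r// lerDl mulr_ge0.
  apply: le_trans (ler_wpM2l CT0 e1) _.
  rewrite mulrA ler_wpM2r ?powR_ge0//.
  by rewrite mulrAC ler_wpM2r// lerDr.
Qed.
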